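(* Let $w:I\to(0,\infty)$ be a decreasing weight on $I=(0,a)$, $0<a\le\infty$, with $W(t)=\int_0^t w\,dm<\infty$ for all $t\in I$. Let $b=\int_I w\,dm\in(0,\infty]$, $J=(0,b)$, and let $E$ be a fully symmetric Banach function space on $J$ with support $J$. If $E$ has the Fatou property and $w$ is regular, then $(\Lambda_{E',w})'=M_{E,w}$ as sets, and the gauge $\|\cdot\|_{M_{E,w}}$ is equivalent to the norm $\|\cdot\|_{(\Lambda_{E',w})'}$.
   Context: $m$ is Lebesgue measure; functions are identified when equal a.e.; ''decreasing'' means non-increasing. $L^0(I)$ is the space of real Lebesgue measurable functions on $I$. The weight $w$ is regular if $W(t)\le C\,t\,w(t)$ for some $C\ge1$ and all $t\in I$. For a measure $\mu$ and a $\mu$-measurable $f$ on $\Omega$, $d_f^\mu(s)=\mu\{|f|>s\}$ and $f^{*,\mu}(t)=\inf\{s>0:d_f^\mu(s)\le t\}$ for $0\le t<\mu(\Omega)$; $f^*$ is the rearrangement for $\mu=m$, and $f^{*,w}$ the rearrangement with respect to the measure $w\,dm$ on $I$, a function on $J$. For functions on $J$, $g\prec h$ means $\int_0^x g^*\,dm\le\int_0^x h^*\,dm$ for all $x\in J$. A Banach function space on an interval is a solid linear subspace $E$ of $L^0$ with full support, complete under a monotone norm ($|f|\le|g|$ a.e. implies $\|f\|_E\le\|g\|_E$). It is fully symmetric if equimeasurable functions have equal norms and $f\prec g$, $f\in L^0$, $g\in E$ imply $f\in E$ and $\|f\|_E\le\|g\|_E$. ''Support $J$'' means $\chi_A\in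 E$ whenever $m(A)<\infty$. $E$ has the Fatou property if $f_n\in E$, $f_n\uparrow f$ a.e., $\sup_n\|f_n\|_E<\infty$ imply $f\in E$ and $\|f_n\|_E\uparrow\|f\|_E$. The Köthe dual $F'$ of a Banach function space $F$ (on $J$ or $I$, Lebesgue measure) is the set of measurable $f$ with $\|f\|_{F'}=\sup\{\int|fg|\,dm:\|g\|_F\le1\}<\infty$. For a fully symmetric space $F$ on $J$ (here $F=E$ or $F=E'$): $F_w=\{f\in L^0(I):f^{*,w}\in F\}$, $\|f\|_{F_w}=\|f^{*,w}\|_F$; $\Lambda_{F,w}=\{f\in L^0(I):f^*\in F_w\}$, $\|f\|_{\Lambda_{F,w}}=\|f^*\|_{F_w}$; $M_{F,w}=\{f\in L^0(I): f^*/w\in F_w\}$ with gauge $\|f\|_{M_{F,w}}=\|f^*/w\|_{F_w}$. *)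

(* Defs.v *)
From HB Require Import structures.
From mathcomp Require Export all_boot all_order all_algebra.
From mathcomp Require Export all_classical all_reals all_analysis.

Set Implicit Arguments.
Unset Strict Implicit.
Unset Printing Implicit Defensive.
Import Order.TTheory GRing.Theory Num.Theory.
Import numFieldNormedType.Exports.
Local Open Scope classical_set_scope.
Local Open Scope ring_scope.

(* Conventions. A function on an interval D = (0, l), 0 < l <= +oo, is
   represented by a total function R -> R whose values outside D are
   irrelevant. Measurability refers to the Borel sigma-algebra of R: functions
   are identified when equal a.e., and every Lebesgue measurable function is
   a.e. equal to a Borel one, so the spaces of classes are the usual ones. *)

Definition itv0 (R : realType) (l : \bar R) : set R :=
  [set x : R | 0 < x /\ (x%:E < l)%E].

Definition L0 (R : realType) (D : set R) : set (R -> R) :=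
  [set f | measurable_fun D f].

Definition ae_on (R : realType) (D : set R) (P : R -> Prop) : Prop :=
  {ae (@lebesgue_measure R), forall x, D x -> P x}.

Definition ae_dominated (R : realType) (D : set R) (f g : R -> R) : Prop :=
  ae_on D (fun x => `|f x| <= `|g x|).

(* The measure of density w with respect to Lebesgue measure. *)
Definition wmeasure (R : realType) (w : R -> R) (A : set R) : \bar R :=
  (\int[@lebesgue_measure R]_(x in A) (w x)%:E)%E.

Definition distribution_fun (R : realType) (nu : set R -> \bar R) (D : set R)
    (f : R -> R) (s : R) : \bar R :=
  nu (D `&` [set x | s < `|f x|]).

(* The infimum of the empty set is +oo, so the rearrangement is extended
   real-valued; only its values at 0 <= t < nu D are meaningful. *)
Definition rearrangement (R : realType) (nu : set R -> \bar R) (D : set R)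
    (f : R -> R) (t : R) : \bar R :=
  ereal_inf [set s%:E | s in
    [set s : R | 0 < s /\ (distribution_fun nu D f s <= t%:E)%E]].

Definition star (R : realType) (D : set R) (f : R -> R) : R -> \bar R :=
  rearrangement (@lebesgue_measure R) D f.

Definition wstar (R : realType) (D : set R) (w f : R -> R) : R -> \bar R :=
  rearrangement (wmeasure w) D f.

(* For functions on (0, l). *)
Definition submajorized (R : realType) (l : \bar R) (g h : R -> R) : Prop :=
  forall x : R, itv0 l x ->
    (\int[@lebesgue_measure R]_(t in itv0 x%:E) star (itv0 l) g t <=
     \int[@lebesgue_measure R]_(t in itv0 x%:E) star (itv0 l) h t)%E.

Definition equimeasurable (R : realType) (D : set R) (f g : R -> R) : Prop :=
  forall s : R, distribution_fun (@lebesgue_measure R) D f s =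
                distribution_fun (@lebesgue_measure R) D g s.

(* A set of functions with a gauge; the values of the gauge off the carrier are
   irrelevant. *)
Record fun_space (R : realType) := FunSpace {
  carrier : set (R -> R) ;
  gauge : (R -> R) -> R }.

(* Membership of an extended real-valued function on D: it must be finite a.e.
   on D, and is then identified with its real-valued version. *)
Definition emem (R : realType) (D : set R) (F : fun_space R)
    (g : R -> \bar R) : Prop :=
  ae_on D (fun x => g x \is a fin_num) /\ carrier F (fine \o g).

Definition egauge (R : realType) (F : fun_space R) (g : R -> \bar R) : R :=
  gauge F (fine \o g).

Definition solid_subspace (R : realType) (D : set R) (E : fun_space R) : Prop :=
  [/\ carrier E `<=` L0 D,
      carrier E (cst 0),
      forall (c : R) f g, carrier E f -> carrier E g ->
        carrier E (fun x => c * f x + g x) &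
      forall f g, L0 D f -> carrier E g -> ae_dominated D f g -> carrier E f].

Definition full_support (R : realType) (D : set R) (E : fun_space R) : Prop :=
  forall A : set R, measurable A -> A `<=` D ->
    (0 < (@lebesgue_measure R) A)%E ->
    exists2 f, carrier E f & ~ ae_on A (fun x => f x = 0).

Definition monotone_norm (R : realType) (D : set R) (E : fun_space R) : Prop :=
  [/\ forall f, carrier E f -> (gauge E f = 0 <-> ae_on D (fun x => f x = 0)),
      forall (c : R) f, carrier E f ->
        gauge E (fun x => c * f x) = `|c| * gauge E f,
      forall f g, carrier E f -> carrier E g ->
        gauge E (fun x => f x + g x) <= gauge E f + gauge E g &
      forall f g, carrier E f -> carrier E g -> ae_dominated D f g ->
        gauge E f <= gauge E g].

Definition complete_space (R : realType) (E : fun_space R) : Prop :=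
  forall u : nat -> R -> R, (forall n, carrier E (u n)) ->
    (forall e : R, 0 < e -> exists N : nat, forall m n : nat,
       (N <= m)%N -> (N <= n)%N -> gauge E (fun x => u m x - u n x) < e) ->
    exists2 f, carrier E f &
      (fun n : nat => gauge E (fun x => u n x - f x)) @ \oo --> (0 : R).

Definition banach_function_space (R : realType) (D : set R)
    (E : fun_space R) : Prop :=
  [/\ solid_subspace D E, full_support D E, monotone_norm D E &
      complete_space E].

Definition fully_symmetric (R : realType) (l : \bar R)
    (E : fun_space R) : Prop :=
  (forall f g, carrier E f -> L0 (itv0 l) g -> equimeasurable (itv0 l) f g ->
     carrier E g /\ gauge E f = gauge E g) /\
  (forall f g, L0 (itv0 l) f -> carrier E g -> submajorized l f g ->
     carrier E f /\ gauge E f <= gauge E g).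

Definition has_support (R : realType) (D : set R) (E : fun_space R) : Prop :=
  forall A : set R, measurable A -> A `<=` D ->
    ((@lebesgue_measure R) A < +oo)%E -> carrier E (\1_A : R -> R).

(* The sequences are nonnegative: for sign-changing ones the norms need not
   increase. *)
Definition fatou_property (R : realType) (D : set R) (E : fun_space R) : Prop :=
  forall (u : nat -> R -> R) (f : R -> R),
    (forall n, carrier E (u n)) -> L0 D f ->
    ae_on D (fun x => forall n, 0 <= u n x <= u n.+1 x) ->
    ae_on D (fun x => (fun n : nat => u n x) @ \oo --> f x) ->
    (exists M : R, forall n, gauge E (u n) <= M) ->
    [/\ carrier E f,
        forall n, gauge E (u n) <= gauge E (u n.+1) &
        (fun n : nat => gauge E (u n)) @ \oo --> gauge E f].

Definition kothe_sup (R : realType) (D : set R) (F : fun_space R)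
    (f : R -> R) : \bar R :=
  ereal_sup [set (\int[@lebesgue_measure R]_(x in D) `|f x * g x|%:E)%E
            | g in [set g | carrier F g /\ gauge F g <= 1]].

Definition kothe_dual (R : realType) (D : set R)
    (F : fun_space R) : fun_space R :=
  FunSpace [set f | L0 D f /\ (kothe_sup D F f < +oo)%E]
           (fun f => fine (kothe_sup D F f)).

Definition weight_primitive (R : realType) (w : R -> R) (t : R) : \bar R :=
  wmeasure w (itv0 t%:E).

Definition decreasing_weight (R : realType) (a : \bar R) (w : R -> R) : Prop :=
  [/\ forall t, itv0 a t -> 0 < w t,
      forall s t, itv0 a s -> itv0 a t -> s <= t -> w t <= w s &
      forall t, itv0 a t -> (weight_primitive w t < +oo)%E].

Definition regular_weight (R : realType) (a : \bar R) (w : R -> R) : Prop :=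
  exists2 C : R, 1 <= C &
    forall t, itv0 a t -> (weight_primitive w t <= (C * t * w t)%:E)%E.

Definition weight_total (R : realType) (a : \bar R) (w : R -> R) : \bar R :=
  wmeasure w (itv0 a).

(* F_w, Lambda_{F,w} and M_{F,w}, for F a space on J = (0, weight_total a w);
   all three consist of functions on I = (0, a). *)
Definition weighted_space (R : realType) (a : \bar R) (w : R -> R)
    (F : fun_space R) : fun_space R :=
  FunSpace [set f | L0 (itv0 a) f /\
                    emem (itv0 (weight_total a w)) F (wstar (itv0 a) w f)]
           (fun f => egauge F (wstar (itv0 a) w f)).

Definition Lambda_space (R : realType) (a : \bar R) (w : R -> R)
    (F : fun_space R) : fun_space R :=
  FunSpace [set f | L0 (itv0 a) f /\
                    emem (itv0 a) (weighted_space a w F) (star (itv0 a) f)]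
           (fun f => egauge (weighted_space a w F) (star (itv0 a) f)).

Definition star_over_weight (R : realType) (a : \bar R) (w f : R -> R)
    (t : R) : \bar R :=
  (star (itv0 a) f t * ((w t)^-1)%:E)%E.

Definition M_space (R : realType) (a : \bar R) (w : R -> R)
    (F : fun_space R) : fun_space R :=
  FunSpace [set f | L0 (itv0 a) f /\
                    emem (itv0 a) (weighted_space a w F)
                         (star_over_weight a w f)]
           (fun f => egauge (weighted_space a w F) (star_over_weight a w f)).

Definition equivalent_gauges (R : realType) (E F : fun_space R) : Prop :=
  exists c C : R, [/\ 0 < c, 0 < C &
    forall f, carrier E f ->
      c * gauge F f <= gauge E f /\ gauge E f <= C * gauge F f].

(* Main.v *)
(* M_{E,w} is contained in the dual by the Hardy-Littlewood inequality, applied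
   first to Lebesgue measure on I and then to the measure w dm.

   Conversely, let f have norm K in the dual. On a geometric grid tau_i = alpha 2^i,
   put x_i = W(tau_i) and z_i = f^*(tau_i) tau_i. By regularity, f^*/w is at most
   a constant times z_i / x_{i+1} on [tau_i, tau_{i+1}). If g in E is decreasing
   and z_0 + ... + z_i is at most the integral of g over (0, x_i) for every i, then
   the rearrangement of the truncation of f^*/w to the grid is submajorized by a
   multiple of g, so that its norm is at most a multiple of the norm of g. By the
   finite-dimensional Hahn-Banach theorem there are weights lam_i >= 0, such that
   h = \sum_i lam_i \1_(0, x_i) is in the unit ball of E', for which
   \sum_i lam_i (z_0 + ... + z_i) bounds the norm of the truncation up to a
   constant. This sum is at most a constant times the integral of |f| against a
   function with rearrangement h(W), hence at most a constant times K. The Fatou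
   property removes the truncation. In particular E'' = E is not needed. *)
Require Import Defs.
From mathcomp Require Import measurable_realfun.
From mathcomp Require Import ring lra.
Set Implicit Arguments.
Unset Strict Implicit.
Unset Printing Implicit Defensive.
Import Order.TTheory GRing.Theory Num.Theory.
Import numFieldNormedType.Exports.
Local Open Scope classical_set_scope.
Local Open Scope ring_scope.

(** The quotient of [f^*] by [w] need not be monotone, so its rearrangement for [w dm] has no closed
    form. Only a step bound is used: each nonzero value is at most one of the numbers
    [z_i / x_{i+1}], up to a constant, on a range ending at [x_{i+1}]. This reduces submajorization
    to finitely many conditions on primitives, for which the Hahn-Banach theorem in [R^n] suffices.

    The test functions must realise on [I] what the weights [lam_i] prescribe on [J]. As [w dm]
    gives [(0, tau_i)] the measure [x_i], layers of height [lam_i] on nested sets of Lebesgue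
    measure [tau_i] do so; such sets exist inside the superlevel sets of [f] because Lebesgue
    measure has no atoms.

    The gauges compare with the constants [1] and [16 C]. The latter collects [C] from regularity
    and four factors 2: from [tau_{i+1} = 2 tau_i], from testing at half the height [f^*(tau_i)] to
    make an inequality strict, from replacing [tau_k] by the layer width [tau_k - tau_{k-1}], and
    from the submajorization. *)

(** * Intervals, weighted measures and rearrangements *)

Section weighted_measure.
Context {R : realType}.
Local Notation mu := (@lebesgue_measure R).
Implicit Types (l : \bar R) (D : set R) (w f g : R -> R).

Lemma measurable_itv0 l : measurable (itv0 l).
Proof.
apply: is_interval_measurable => x y [x0 xl] [y0 yl] z /andP[xz zy]; split.
  exact: lt_le_trans xz.
by apply: le_lt_trans yl; rewrite lee_fin.
Qed.

Lemma itv0S l l' : (l <= l')%E -> itv0 l `<=` itv0 l'.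
Proof. by move=> ll' x [x0 xl]; split=> //; exact: lt_le_trans ll'. Qed.

Lemma itv0_le l (s t : R) : itv0 l t -> 0 < s -> s <= t -> itv0 l s.
Proof. by move=> [t0 tl] s0 st; split=> //; apply: le_lt_trans tl; rewrite lee_fin. Qed.

Lemma itv0S_mem l (t : R) : itv0 l t -> itv0 t%:E `<=` itv0 l.
Proof. by move=> [_ /ltW]; exact: itv0S. Qed.

Lemma lebesgue_measure_itv0 l : (0 <= l)%E -> mu (itv0 l) = l.
Proof.
case: l => [r| |] //; rewrite ?lee_fin => r0.
- have -> : itv0 r%:E = [set` `]0, r[] :> set R.
    by apply/seteqP; split => x; rewrite /itv0/= in_itv/= lte_fin;
      [move=> [-> ->]|move=> /andP[]].
  rewrite lebesgue_measure_itv/= lte_fin; case: ltP => [|r0'].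
    by rewrite sube0.
  by congr EFin; apply/eqP; rewrite eq_le r0 r0'.
- have -> : itv0 +oo%E = [set` `]0, +oo[] :> set R.
    by apply/seteqP; split => x; rewrite /itv0/= in_itv/= andbT ltry;
      [move=> []|move=> ->].
  by rewrite lebesgue_measure_itv/= ltry addye.
Qed.

Lemma ae_onW D (P Q : R -> Prop) : (forall x, D x -> P x -> Q x) ->
  ae_on D P -> ae_on D Q.
Proof.
by move=> PQ; apply: (@filterS _ _ (ae_filter_ringOfSetsType mu)) => x Px Dx;
  exact: (PQ _ Dx (Px Dx)).
Qed.

Lemma ae_onT D (P : R -> Prop) : (forall x, D x -> P x) -> ae_on D P.
Proof. by move=> DP; apply: aeW. Qed.

Lemma ae_onI D (P Q : R -> Prop) : ae_on D P -> ae_on D Q ->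
  ae_on D (fun x => P x /\ Q x).
Proof.
move=> aP aQ; apply: (@filterS2 _ _ (ae_filter_ringOfSetsType mu) _ _ _ _ aP aQ) => x Px Qx Dx.
by split; [exact: Px|exact: Qx].
Qed.

Context (D : set R) (w : R -> R).
Hypotheses (mD : measurable D) (mw : measurable_fun D w)
  (w0 : forall x, D x -> 0 <= w x).

Let mwS A : measurable A -> A `<=` D -> measurable_fun A (fun x => (w x)%:E).
Proof. by move=> mA AD; apply/measurable_EFinP; exact: measurable_funS mw. Qed.

Lemma le_wmeasure (A B : set R) : measurable A -> measurable B -> A `<=` B ->
  B `<=` D -> (wmeasure w A <= wmeasure w B)%E.
Proof.
move=> mA mB AB BD; apply: ge0_subset_integral => //; first exact: mwS.
by move=> x Bx; rewrite lee_fin w0//; exact: BD.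
Qed.

Lemma wmeasure_ge0 (A : set R) : A `<=` D -> (0 <= wmeasure w A)%E.
Proof. by move=> AD; apply: integral_ge0 => x Ax; rewrite lee_fin w0//; exact: AD. Qed.

Lemma wmeasure_set0 : wmeasure w set0 = 0%E.
Proof. exact: integral_set0. Qed.

Lemma wmeasure_cvg (A : (set R)^nat) : (forall n, measurable (A n)) ->
  (forall n, A n `<=` D) -> {homo A : n m / (n <= m)%N >-> n `<=` m} ->
  (fun n => wmeasure w (A n)) @ \oo --> wmeasure w (\bigcup_n A n).
Proof.
move=> mA AD hA; apply: ge0_nondecreasing_set_cvg_integral => //.
- by move=> n m nm; apply/subsetPset; exact: hA.
- by move=> i; apply: mwS.
- by move=> i x Ax; rewrite lee_fin w0//; exact: (AD i).
Qed.

Lemma wmeasure_lt_bigcup (A : (set R)^nat) (t : \bar R) :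
  (forall n, measurable (A n)) ->
  (forall n, A n `<=` D) -> {homo A : n m / (n <= m)%N >-> n `<=` m} ->
  (t < wmeasure w (\bigcup_n A n))%E -> exists n, (t < wmeasure w (A n))%E.
Proof.
move=> mA AD hA tA; apply: contrapT => /forallNP H.
have c := wmeasure_cvg mA AD hA.
suff : (wmeasure w (\bigcup_n A n) <= t)%E by rewrite leNgt tA.
rewrite -(cvg_lim _ c)//; apply: lime_le; first by apply/cvg_ex; eexists; exact: c.
by apply: nearW => n; rewrite leNgt; apply/negP/H.
Qed.

Lemma measurable_superlevel (f : R -> R) (s : R) : measurable_fun D f ->
  measurable (D `&` [set x | s < `|f x|]).
Proof.
move=> mf; rewrite (_ : [set x | _] = (fun x => `|f x|) @^-1` `]s, +oo[).
  have mnf : measurable_fun D (fun x => `|f x|) by apply: measurableT_comp.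
  exact: mnf.
by apply/seteqP; split => x /=; rewrite in_itv/= andbT.
Qed.

Lemma measurable_superlevel_ge (f : R -> R) (s : R) : measurable_fun D f ->
  measurable (D `&` [set x | s <= `|f x|]).
Proof.
move=> mf; rewrite (_ : [set x | _] = (fun x => `|f x|) @^-1` `[s, +oo[).
  have mnf : measurable_fun D (fun x => `|f x|) by apply: measurableT_comp.
  exact: mnf.
by apply/seteqP; split => x /=; rewrite in_itv/= andbT.
Qed.

Lemma le_distribution_fun (f : R -> R) (s s' : R) : measurable_fun D f ->
  s <= s' -> (distribution_fun (wmeasure w) D f s' <= distribution_fun (wmeasure w) D f s)%E.
Proof.
move=> mf ss'; apply: le_wmeasure; [exact: measurable_superlevel..| |].
  by move=> x [Dx /= /(le_lt_trans ss')].
by move=> x [].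
Qed.

Lemma rearrangement_ge0 (f : R -> R) (t : R) : (0 <= wstar D w f t)%E.
Proof.
by apply: le_ereal_inf_tmp => _ [s [/ltW s0 _] <-]; rewrite lee_fin.
Qed.

Lemma rearrangement_le (f : R -> R) (s t : R) : measurable_fun D f ->
  0 <= s -> (distribution_fun (wmeasure w) D f s <= t%:E)%E ->
  (wstar D w f t <= s%:E)%E.
Proof.
(* The infimum runs over positive levels, so [s = 0] is reached through [s + e]. *)
move=> mf s0 dst; apply/lee_addgt0Pr => e e0; apply: ereal_inf_lbound.
exists (s + e) => //; split; first by rewrite ltr_wpDl.
by apply: le_trans dst; apply: le_distribution_fun => //; rewrite lerDl ltW.
Qed.

(** The superlevel set at [s] is the increasing union of those at [s + 1/(n+1)]; continuity from
    below makes the distribution function right-continuous, and the equivalence is exact. It shows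
    that superlevel sets of a rearrangement are initial intervals. *)
Lemma rearrangement_gtP (f : R -> R) (s t : R) : measurable_fun D f -> 0 <= s ->
  (s%:E < wstar D w f t)%E = (t%:E < distribution_fun (wmeasure w) D f s)%E.
Proof.
move=> mf s0; apply/idP/idP => [|tds].
  by rewrite !ltNge; apply: contra; exact: rearrangement_le.
have DE : D `&` [set x | s < `|f x|] =
    \bigcup_n (D `&` [set x | s + n.+1%:R^-1 < `|f x|]).
  apply/seteqP; split => [x [Dx /= sx]|x [n _ [Dx /= sx]]]; last first.
    by split => //=; apply: lt_trans sx; rewrite ltrDl.
  have [n nx] := ltr_add_invr sx.
  by exists n => //; split.
have [n tn] : exists n, (t%:E < distribution_fun (wmeasure w) D f (s + n.+1%:R^-1))%E.
  apply: wmeasure_lt_bigcup.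
  - by move=> n; exact: measurable_superlevel.
  - by move=> n x [].
  - move=> n m nm x [Dx /= nx]; split => //=; apply: le_lt_trans nx.
    by rewrite lerD2l lef_pV2 ?posrE// ler_nat.
  - by rewrite -DE.
apply: (@lt_le_trans _ _ (s + n.+1%:R^-1)%:E); first by rewrite lte_fin ltrDl.
apply: le_ereal_inf_tmp => _ [r [r0 dr] <-]; rewrite lee_fin leNgt; apply/negP => rn.
have := lt_le_trans tn (le_distribution_fun mf (ltW rn)).
by rewrite ltNge dr.
Qed.

Lemma rearrangement_nonincreasing (f : R -> R) (s t : R) :
  s <= t -> (wstar D w f t <= wstar D w f s)%E.
Proof.
move=> st; apply: ereal_inf_le_tmp => _ [r [r0 dr] <-]; exists r => //.
by split=> //; apply: le_trans dr _; rewrite lee_fin.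
Qed.

Lemma le_rearrangement (f g : R -> R) (t : R) : measurable_fun D f ->
  measurable_fun D g -> (forall x, D x -> `|f x| <= `|g x|) ->
  (wstar D w f t <= wstar D w g t)%E.
Proof.
move=> mf mg fg; apply: ereal_inf_le_tmp => _ [r [r0 dr] <-]; exists r => //.
split=> //; apply: le_trans dr; apply: le_wmeasure;
  [exact: measurable_superlevel..| |]; last by move=> x [].
by move=> x [Dx /= rx]; split => //=; apply: lt_le_trans rx (fg _ Dx).
Qed.

End weighted_measure.


(** * Approximation by layers of equal height *)

Section staircase.
Context {R : realType}.
Local Notation mu := (@lebesgue_measure R).

Lemma measurable_fun_nonincreasing_ereal (D : set R) (f : R -> \bar R) :
  measurable D -> (forall s t, s <= t -> (f t <= f s)%E) -> measurable_fun D f.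
Proof.
move=> mD hf; apply: (measurability _ (ErealGenOInfty.measurableE R)) => // _ [_ [r ->] <-].
apply: measurableI => //; apply: is_interval_measurable => s t /=.
rewrite !in_itv/= !andbT => fs ft u /andP[su ut].
by rewrite in_itv/= andbT (lt_le_trans ft)// hf.
Qed.

Lemma integral_indic_mul (D A : set R) (F : R -> \bar R) : A `<=` D ->
  (\int[mu]_(x in D) ((\1_A x)%:E * F x) = \int[mu]_(x in A) F x)%E.
Proof.
move=> AD; rewrite -{2}(setIidr AD) integral_mkcondr; apply: eq_integral => x _.
rewrite patchE indicE; case: ifPn => xA; first by rewrite mul1e.
by rewrite mul0e.
Qed.

Lemma measurable_fun_nonincreasing_itv0 (l : \bar R) (f : R -> R) :
  (forall s t, itv0 l s -> itv0 l t -> s <= t -> f t <= f s) ->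
  measurable_fun (itv0 l) f.
Proof.
move=> fdec; apply: (measurability _ (RGenCInfty.measurableE R)) => // _ [_ [r ->] <-].
apply: is_interval_measurable => s t /= [ls fs] [lt ft] u /andP[su ut].
have lu : itv0 l u by apply: itv0_le lt _ ut; apply: lt_le_trans su; case: ls.
split=> //; move: ft; rewrite /= !in_itv/= !andbT => /le_trans; apply.
exact: fdec.
Qed.

(* The sum over 0 < k <= m of the layers d * [k d < y]. In a product of two such
   sums, with y replaced by |f| and |g|, only the measures of the intersections
   of superlevel sets appear: this gives the Hardy-Littlewood inequality without
   Fubini's theorem. *)
Definition stair (m : nat) (d : R) (y : \bar R) : R :=
  \sum_(k < m) d * ((k.+1%:R * d)%:E < y)%E%:R.

Lemma stair_ge0 m d y : 0 <= d -> 0 <= stair m d y.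
Proof. by move=> d0; apply: sumr_ge0 => k _; rewrite mulr_ge0. Qed.

Lemma stair_le m d y : 0 <= d -> (0 <= y)%E -> ((stair m d y)%:E <= y)%E.
Proof.
move=> d0 y0; rewrite /stair; elim: m => [|m IH]; first by rewrite big_ord0.
rewrite big_ord_recr/=; case: ltP => my; last by rewrite mulr0 addr0.
apply: le_trans (ltW my); rewrite lee_fin mulr1 -natr1 mulrDl mul1r lerD2r.
rewrite -[m in X in _ <= X]card_ord mulr_natl -sumr_const; apply: ler_sum => i _.
by case: (_ < _)%E; rewrite ?mulr1 ?mulr0.
Qed.

Lemma stair_ge m d (y : R) : 0 <= d -> y <= m.+1%:R * d ->
  y - d <= stair m d y%:E.
Proof.
(* The minimum with [m * d] accounts for the cutoff and makes the induction on [m] possible. *)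
move=> d0 ym; suff : Num.min (y - d) (m%:R * d) <= stair m d y%:E.
  apply: le_trans; rewrite le_min lexx/=.
  by move: ym; rewrite -natr1 mulrDl mul1r lerBlDr.
rewrite /stair; elim: m {ym} => [|m IH].
  by rewrite big_ord0 mul0r ge_min lexx orbT.
rewrite big_ord_recr/= lte_fin; case: ltP => my; rewrite ?mulr1 ?mulr0 ?addr0.
  rewrite ge_min; apply/orP; right.
  rewrite -[in leLHS]natr1 mulrDl mul1r lerD2r.
  rewrite -[m in X in X <= _]card_ord mulr_natl -sumr_const; apply: ler_sum => i _.
  rewrite lte_fin (le_lt_trans _ my) ?mulr1// ler_wpM2r// ler_nat.
  by rewrite ltnS; exact/ltnW.
apply: le_trans IH; rewrite le_min ge_min lexx/= ge_min; apply/orP; left.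
by rewrite lerBlDr; move: my; rewrite -natr1 mulrDl mul1r.
Qed.

(** The [(n+1)^2] layers of height [1/(n+1)] reach up to [n+1]: the mesh tends to 0 while the cutoff
    tends to infinity. *)
Lemma stair_cvg (y : R) : 0 <= y ->
  (fun n => stair (n.+1 ^ 2) n.+1%:R^-1 y%:E) @ \oo --> y.
Proof.
move=> y0; apply: (@squeeze_cvgr _ _ _ _ (fun n => y - n.+1%:R^-1) (fun=> y)).
- near=> n; apply/andP; split; last first.
    by rewrite -lee_fin; apply: stair_le; rewrite ?invr_ge0 ?lee_fin.
  apply: stair_ge; first by rewrite invr_ge0.
  apply: (@le_trans _ _ n.+1%:R).
    near: n; exists (Num.bound y) => // n /= yn.
    apply: le_trans (ltW (archi_boundP y0)) _; rewrite ler_nat; exact: leqW.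
  by rewrite ler_pdivlMr// -natrM ler_nat mulnn leqW.
- rewrite -[X in _ --> X]subr0; apply: cvgB; first exact: cvg_cst.
  exact: cvg_harmonic.
- exact: cvg_cst.
Unshelve. all: by end_near. Qed.

End staircase.

(** * The Hardy-Littlewood inequality for a weighted measure *)

Section hardy_littlewood.
Context {R : realType}.
Local Notation mu := (@lebesgue_measure R).
Context (D : set R) (w : R -> R).
Hypotheses (mD : measurable D) (mw : measurable_fun D w)
  (w0 : forall x, D x -> 0 <= w x).

Lemma measurable_wstar (f : R -> R) A : measurable A ->
  measurable_fun A (wstar D w f).
Proof.
move=> mA; apply: measurable_fun_nonincreasing_ereal => //.
exact: rearrangement_nonincreasing.
Qed.

Lemma measurable_stair (f : R -> R) m d : measurable_fun D f -> 
  measurable_fun D (fun x => stair m d (`|f x|)%:E).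
Proof.
move=> mf; apply: measurable_sum => k; apply: measurable_funM; first exact: measurable_cst.
under eq_fun do rewrite lte_fin.
apply: (measurableT_comp (f := fun b : bool => (b%:R : R))) => //.
apply: measurable_fun_ltr; first exact: measurable_cst.
by apply: measurableT_comp.
Qed.

(** Expanded, the left side is a sum of [d * d] times measures of intersections of superlevel sets
    of [f] and [g]. On the right these become initial intervals of the same measures; one contains
    the other, so their intersection has the smaller measure, which bounds that of the original
    intersection. *)
Lemma integral_stair_le (f g : R -> R) m d : measurable_fun D f ->
  measurable_fun D g -> 0 <= d ->
  (\int[mu]_(x in D) (stair m d `|f x|%:E * stair m d `|g x|%:E * w x)%:E <=
   \int[mu]_(t in itv0 (wmeasure w D))
      (stair m d (wstar D w f t) * stair m d (wstar D w g t))%:E)%E.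
Proof.
move=> mf mg d0.
pose F (h : R -> R) (k : 'I_m) : set R := D `&` [set x | k.+1%:R * d < `|h x|].
pose P (h : R -> R) (k : 'I_m) : set R := itv0 (distribution_fun (wmeasure w) D h (k.+1%:R * d)).
have mF (h : R -> R) k : measurable_fun D h -> measurable (F h k).
  by move=> mh; exact: measurable_superlevel.
have FD (h : R -> R) k : F h k `<=` D by move=> x [].
have PD (h : R -> R) k : measurable_fun D h -> P h k `<=` itv0 (wmeasure w D).
  by move=> mh; apply: itv0S; apply: (@le_wmeasure _ D) => //; exact: mF.
have -> : (\int[mu]_(x in D) (stair m d `|f x|%:E * stair m d `|g x|%:E * w x)%:E =
    \sum_(p : 'I_m * 'I_m) (d * d)%:E * wmeasure w (F f p.1 `&` F g p.2))%E.
  under eq_integral => x /[!inE] Dx.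
    rewrite /stair big_distrlr/= pair_big/= mulr_suml -sumEFin.
    under eq_bigr => p _.
      have -> : (d * (((p.1).+1%:R * d)%:E < `|f x|%:E)%E%:R *
        (d * (((p.2).+1%:R * d)%:E < `|g x|%:E)%E%:R) * w x)%:E =
        ((d * d)%:E * ((\1_(F f p.1 `&` F g p.2) x)%:E * (w x)%:E))%E.
        rewrite -!EFinM; congr EFin; rewrite indicE in_setI !lte_fin.
        have memF (h : R -> R) k : (x \in F h k) = (k.+1%:R * d < `|h x|).
          by apply/idP/idP => [|?]; rewrite inE; [case|].
        rewrite !memF.
        by do 2 case: (_ < _); rewrite /= ?(mulr0,mul0r,mulr1,mul1r).
      over.
    over.
  rewrite ge0_integral_sum//.
  - apply: eq_bigr => p _; rewrite ge0_integralZl_EFin//.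
    + congr (_ * _)%E; rewrite integral_indic_mul// => x [] [] //.
    + by move=> x Dx; rewrite mule_ge0// lee_fin// w0.
    + apply: emeasurable_funM; last exact/measurable_EFinP.
      by apply/measurable_EFinP; apply: measurable_indic; apply: measurableI; exact: mF.
    + exact: mulr_ge0.
  - move=> p; apply: emeasurable_funM; first exact: measurable_cst.
    apply: emeasurable_funM; last exact/measurable_EFinP.
    by apply/measurable_EFinP; apply: measurable_indic; apply: measurableI; exact: mF.
  - by move=> p x Dx; rewrite !mule_ge0// ?lee_fin ?mulr_ge0// w0.
have mJ : measurable (itv0 (wmeasure w D)) by exact: measurable_itv0.
have -> : (\int[mu]_(t in itv0 (wmeasure w D))
      (stair m d (wstar D w f t) * stair m d (wstar D w g t))%:E =
    \sum_(p : 'I_m * 'I_m) (d * d)%:E * mu (P f p.1 `&` P g p.2))%E.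
  under eq_integral => t /[!inE] [[t0 tb]].
    rewrite /stair big_distrlr/= pair_big/= -sumEFin.
    under eq_bigr => p _.
      have -> : (d * (((p.1).+1%:R * d)%:E < wstar D w f t)%E%:R *
        (d * (((p.2).+1%:R * d)%:E < wstar D w g t)%E%:R))%:E =
        ((d * d)%:E * (\1_(P f p.1 `&` P g p.2) t)%:E)%E.
        rewrite -!EFinM; congr EFin; rewrite indicE in_setI.
        rewrite !rearrangement_gtP//; try exact: mulr_ge0.
        have memP h k : (t \in P h k) = (t%:E < distribution_fun (wmeasure w) D h (k.+1%:R * d))%E.
          by apply/idP/idP; rewrite inE// => -[].
        rewrite !memP.
        by do 2 case: (_ < _)%E; rewrite /= ?(mulr0,mul0r,mulr1,mul1r).
      over.
    over.
  rewrite ge0_integral_sum//.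
  - apply: eq_bigr => p _; rewrite ge0_integralZl_EFin//.
    + rewrite integral_indic//; try exact: measurable_itv0.
        rewrite (@setIidl _ (P f p.1 `&` _))// => x [+ _]; exact: PD.
      by apply: measurableI; exact: measurable_itv0.
    + by apply/measurable_EFinP; apply: measurable_indic; apply: measurableI;
      exact: measurable_itv0.
    + exact: mulr_ge0.
  - move=> p; apply: emeasurable_funM; first exact: measurable_cst.
    by apply/measurable_EFinP; apply: measurable_indic; apply: measurableI; exact: measurable_itv0.
  - by move=> p x Dx; rewrite mule_ge0// lee_fin// mulr_ge0.
apply: lee_sum => p _; apply: lee_wpmul2l; first by rewrite lee_fin mulr_ge0.
have [fg|/ltW gf] := leP (distribution_fun (wmeasure w) D f (p.1.+1%:R * d))
  (distribution_fun (wmeasure w) D g (p.2.+1%:R * d)).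
- rewrite (@setIidl _ (P f p.1)); last exact: itv0S.
  rewrite lebesgue_measure_itv0; last exact: (wmeasure_ge0 w0).
  apply: (@le_wmeasure _ D) => //; [by apply: measurableI; exact: mF|exact: mF].
- rewrite (@setIidr _ (P f p.1)); last exact: itv0S.
  rewrite lebesgue_measure_itv0; last exact: (wmeasure_ge0 w0).
  apply: (@le_wmeasure _ D) => //; [by apply: measurableI; exact: mF|exact: mF].
Qed.

(** The stairs of step [1/(n+1)] are not monotone in [n], so Fatou's lemma is used on the left; on
    the right every stair lies below the rearrangement. *)
Lemma hardy_littlewood (f g : R -> R) : measurable_fun D f -> measurable_fun D g ->
  (\int[mu]_(x in D) (`|f x * g x| * w x)%:E <=
   \int[mu]_(t in itv0 (wmeasure w D)) (wstar D w f t * wstar D w g t))%E.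
Proof.
move=> mf mg.
pose S n (x : R) := (stair (n.+1 ^ 2) n.+1%:R^-1 `|f x|%:E *
   stair (n.+1 ^ 2) n.+1%:R^-1 `|g x|%:E * w x)%:E.
have Scvg x : D x -> (S ^~ x) @ \oo --> (`|f x * g x| * w x)%:E.
  move=> Dx; apply: cvg_EFin; first exact: nearW.
  rewrite normrM; apply: cvgM; last exact: cvg_cst.
  by apply: cvgM; apply: stair_cvg.
have -> : (\int[mu]_(x in D) (`|f x * g x| * w x)%:E =
    \int[mu]_(x in D) limn_einf (S ^~ x))%E.
  by apply: eq_integral => x /[!inE] Dx; rewrite (cvg_limn_einf_sup (Scvg _ Dx)).1.
apply: le_trans; first apply: fatou => //.
- move=> n; apply/measurable_EFinP; apply: measurable_funM => //.
  by apply: measurable_funM; apply: measurable_stair.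
- by move=> n x Dx; rewrite lee_fin !mulr_ge0 ?stair_ge0 ?invr_ge0// w0.
rewrite limn_einf_lim; apply: lime_le.
  exact: is_cvg_einfs.
apply: nearW => n; apply: (@le_trans _ _ (\int[mu]_(x in D) S n x)%E).
  by apply: ereal_inf_lbound; exists n => /=.
apply: le_trans (integral_stair_le _ mf mg _) _; first by rewrite invr_ge0.
have mJ : measurable (itv0 (wmeasure w D)) by exact: measurable_itv0.
apply: ge0_le_integral => //.
- by move=> t _; rewrite lee_fin mulr_ge0// stair_ge0 ?invr_ge0.
- apply/measurable_EFinP; apply: measurable_funM; apply: measurable_sum => k;
    apply: measurable_funM; try exact: measurable_cst;
    apply: (measurableT_comp (f := fun b : bool => (b%:R : R))) => //;
    apply: measurable_fun_lte; try exact: measurable_cst; exact: measurable_wstar.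
- by apply: emeasurable_funM; exact: measurable_wstar.
- move=> t _; rewrite EFinM; apply: lee_pmul; rewrite ?lee_fin ?stair_ge0 ?invr_ge0//;
    apply: stair_le; rewrite ?invr_ge0//; exact: rearrangement_ge0.
Qed.

End hardy_littlewood.

(** * Rearrangements of functions bounded by nested steps *)

Section step_majorant.
Context {R : realType}.
Local Notation mu := (@lebesgue_measure R).

(** Let [s] be the bound. A point with [|g| > s] lies in some [A i] with [x i <= t], since the steps
    with [t < x i] are counted in full in [s]. By nesting all these points lie in the last such
    [A i], of measure at most [t]. *)
Lemma rearrangement_le_steps (D : set R) (w : R -> R) (n : nat) (A : nat -> set R)
    (x lam : nat -> R) (m0 t : R) (g : R -> R) :
  measurable D -> measurable_fun D w -> (forall y, D y -> 0 <= w y) ->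
  measurable_fun D g ->
  (forall i, (i < n)%N -> measurable (A i) /\ A i `<=` D) ->
  (forall i j, (i <= j)%N -> (j < n)%N -> A i `<=` A j) ->
  (forall i, (i < n)%N -> (wmeasure w (A i) <= (x i)%:E)%E) ->
  0 <= m0 -> (forall i, (i < n)%N -> 0 <= lam i) -> 0 <= t ->
  (forall y, D y -> `|g y| <= m0 + \sum_(i < n) lam i * \1_(A i) y) ->
  (wstar D w g t <= (m0 + \sum_(i < n) lam i * (t < x i)%R%:R)%:E)%E.
Proof.
move=> mD mw w0 mg mA AS wA m00 lam0 t0 gle.
set s := m0 + _.
have s0 : 0 <= s by rewrite addr_ge0// sumr_ge0// => i _; rewrite mulr_ge0// lam0.
have gs y : D y -> (forall j, (j < n)%N -> x j <= t -> ~ A j y) -> `|g y| <= s.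
  move=> Dy nA; apply: le_trans (gle _ Dy) _; rewrite lerD2l; apply: ler_sum => i _.
  rewrite ler_wpM2l ?lam0//; case: ltP => [_|xt]; first by rewrite indicE; case: (_ \in _).
  by rewrite indicE memNset//; exact: nA.
apply: rearrangement_le => //.
have mS := @measurable_superlevel R D mD g s mg.
have [ex|nex] := pselect (exists i, (i < n)%N && (x i <= t)).
  have bd i : (i < n)%N && (x i <= t) -> (i <= n)%N by move=> /andP[/ltnW].
  case: (ex_maxnP ex bd) => k /andP[kn xk] kmax.
  apply: (@le_trans _ _ (wmeasure w (A k))); last first.
    by apply: le_trans (wA _ kn) _; rewrite lee_fin.
  apply: (@le_wmeasure _ D) => //; [exact: (mA _ kn).1| |exact: (mA _ kn).2].
  move=> y [Dy /= sy]; apply: contrapT => nAy; move: sy; apply/negP; rewrite -leNgt.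
  apply: gs => // j jn xj /AS; apply: contra_not nAy; apply=> //.
  by apply: kmax; rewrite jn.
have -> : distribution_fun (wmeasure w) D g s = 0%E.
  rewrite /distribution_fun (_ : _ `&` _ = set0) ?wmeasure_set0//.
  rewrite -subset0 => y [Dy /= sy]; move: sy; apply/negP; rewrite -leNgt.
  by apply: gs => // j jn xj; case: nex; exists j; rewrite jn.
by rewrite lee_fin.
Qed.

Lemma wmeasure_cst1 (A : set R) : measurable A -> wmeasure (cst 1) A = mu A.
Proof.
by move=> mA; rewrite -[RHS]mul1e -integral_cst.
Qed.

Lemma distribution_fun_cst1 (D : set R) (f : R -> R) s : measurable D ->
  measurable_fun D f ->
  distribution_fun (wmeasure (cst 1)) D f s = distribution_fun mu D f s.
Proof. by move=> mD mf; apply: wmeasure_cst1; exact: measurable_superlevel. Qed.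

(** Lebesgue measure is treated as the case [w = 1], so that results for [wmeasure] carry over. *)
Lemma star_wstar (D : set R) (f : R -> R) : measurable D ->
  measurable_fun D f -> star D f = wstar D (cst 1) f.
Proof.
move=> mD mf; apply/funext => t; congr ereal_inf; apply/seteqP.
by split => _ [s [s0 st] <-]; exists s => //; split=> //; move: st; rewrite distribution_fun_cst1.
Qed.

Context (D : set R).
Hypothesis mD : measurable D.

Let m1 : measurable_fun D (cst (1 : R)). Proof. exact: measurable_cst. Qed.
Let ge01 x : D x -> 0 <= cst (1 : R) x. Proof. by []. Qed.

Lemma star_ge0 (f : R -> R) t : (0 <= star D f t)%E.
Proof. by apply: le_ereal_inf_tmp => _ [s [/ltW s0 _] <-]; rewrite lee_fin. Qed.

Lemma star_nonincreasing (f : R -> R) (s t : R) :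
  s <= t -> (star D f t <= star D f s)%E.
Proof.
move=> st; apply: ereal_inf_le_tmp => _ [r [r0 dr] <-]; exists r => //.
by split=> //; apply: le_trans dr _; rewrite lee_fin.
Qed.

Lemma measurable_star (f : R -> R) A : measurable A -> measurable_fun A (star D f).
Proof.
move=> mA; apply: measurable_fun_nonincreasing_ereal => //.
exact: star_nonincreasing.
Qed.

Lemma star_gtP (f : R -> R) (s t : R) : measurable_fun D f -> 0 <= s ->
  (s%:E < star D f t)%E = (t%:E < distribution_fun mu D f s)%E.
Proof.
by move=> mf s0; rewrite star_wstar// (rearrangement_gtP mD m1)// distribution_fun_cst1.
Qed.

Lemma star_le_steps (n : nat) (A : nat -> set R)
    (x lam : nat -> R) (m0 t : R) (g : R -> R) :
  measurable_fun D g ->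
  (forall i, (i < n)%N -> measurable (A i) /\ A i `<=` D) ->
  (forall i j, (i <= j)%N -> (j < n)%N -> A i `<=` A j) ->
  (forall i, (i < n)%N -> (mu (A i) <= (x i)%:E)%E) ->
  0 <= m0 -> (forall i, (i < n)%N -> 0 <= lam i) -> 0 <= t ->
  (forall y, D y -> `|g y| <= m0 + \sum_(i < n) lam i * \1_(A i) y) ->
  (star D g t <= (m0 + \sum_(i < n) lam i * (t < x i)%R%:R)%:E)%E.
Proof.
move=> mg mA AS wA m00 lam0 t0 gle; rewrite star_wstar//.
apply: (@rearrangement_le_steps _ _ _ A) => //.
by move=> i ni; rewrite wmeasure_cst1; [exact: wA|exact: (mA _ ni).1].
Qed.

Lemma hardy_littlewood_star (f g : R -> R) : measurable_fun D f -> measurable_fun D g ->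
  (\int[mu]_(x in D) `|f x * g x|%:E <=
   \int[mu]_(t in itv0 (mu D)) (star D f t * star D g t))%E.
Proof.
move=> mf mg; rewrite !star_wstar// -(wmeasure_cst1 mD).
apply: le_trans (hardy_littlewood mD m1 ge01 mf mg).
by rewrite le_eqVlt; apply/orP; left; apply/eqP; apply: eq_integral => x _; rewrite mulr1.
Qed.

End step_majorant.

(** * The finite-dimensional Hahn-Banach theorem *)

Section hahn_banach.
Context {R : realType}.

(** The second inequality amounts to positive homogeneity, since it may be applied with [t^-1]; one
    inequality is what an infimum yields directly. *)
Definition sublinear (V : lmodType R) (p : V -> R) : Prop :=
  (forall x y, p (x + y) <= p x + p y) /\
  (forall t x, 0 < t -> p (t *: x) <= t * p x).

Section straighten.
Context (V : lmodType R).
Implicit Types (p q : V -> R) (v x y : V).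

Lemma sublinear0 p : sublinear p -> p 0 = 0.
Proof.
move=> [pD pZ]; apply/eqP; rewrite eq_le; apply/andP; split.
  by have := @pZ 2^-1 0 ltac:(by rewrite invr_gt0); rewrite scaler0; lra.
by have := pD 0 0; rewrite addr0; lra.
Qed.

Lemma sublinear_opp p x : sublinear p -> - p (- x) <= p x.
Proof.
by move=> sp; have := sp.1 x (- x); rewrite subrr sublinear0//; lra.
Qed.

(** The minorant is the infimum of [p (x + t *: v) - t * p v] over [t >= 0], bounded below by
    [- p (- x)]. At [x = - v] the value [t = 1] gives the last claim, which makes [q] linear along
    [v]. *)
Lemma sublinear_straighten p v : sublinear p ->
  exists q, [/\ sublinear q, forall x, q x <= p x & q (- v) <= - p v].
Proof.
move=> sp; have [pD pZ] := sp.
pose S x := [set p (x + t *: v) - t * p v | t in [set t : R | 0 <= t]].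
have Slb x : lbound (S x) (- p (- x)).
  move=> _ [t /= t0 <-].
  have : t * p v <= p (t *: v).
    move: t0; rewrite le_eqVlt => /predU1P[<-|t0].
      by rewrite scale0r mul0r sublinear0.
    have := @pZ t^-1 (t *: v) ltac:(by rewrite invr_gt0).
    by rewrite scalerA mulVf ?gt_eqF// scale1r -ler_pdivrMl ?invr_gt0// invrK.
  have := pD (x + t *: v) (- x); rewrite addrAC subrr add0r; lra.
have S0 x : S x !=set0 by exists (p (x + 0 *: v) - 0 * p v); exists 0 => //=.
have hS x : has_inf (S x) by split=> //; exists (- p (- x)); exact: Slb.
have infS x s : S x s -> inf (S x) <= s by move=> Ss; apply: ge_inf => //; case: (hS x).
exists (fun x => inf (S x)); split.
- split=> [x y|t x t0].
  + rewrite -lerBlDr; apply: lb_le_inf => // _ [t /= t0 <-].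
    rewrite lerBlDl -lerBlDr; apply: lb_le_inf => // _ [s /= s0 <-].
    rewrite lerBlDr; apply: (@le_trans _ _ (p (x + y + (t + s) *: v) - (t + s) * p v)).
      by apply: infS; exists (t + s) => //=; exact: addr_ge0.
    have := pD (x + t *: v) (y + s *: v); rewrite addrACA -scalerDl; lra.
  + rewrite -ler_pdivrMl//; apply: lb_le_inf => // _ [s /= s0 <-].
    rewrite ler_pdivrMl//; apply: (@le_trans _ _ (p (t *: x + (t * s) *: v) - (t * s) * p v)).
      by apply: infS; exists (t * s) => //=; rewrite mulr_ge0// ltW.
    have := pZ t (x + s *: v) t0; rewrite scalerDr scalerA; lra.
- by move=> x; apply: infS; exists 0 => //=; rewrite scale0r addr0 mul0r subr0.
- apply: infS; exists 1 => //=.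
  by rewrite scale1r addNr sublinear0// mul1r add0r.
Qed.

(** Linearity along [v] survives in later minorants [q <= q1 <= p], because
    [q (- v) <= q1 (- v) <= - p v <= - q v]. The vectors can thus be treated one by one. *)
Lemma sublinear_minorant (s : seq V) p : sublinear p ->
  exists q, [/\ sublinear q, forall x, q x <= p x &
    forall v, v \in s -> q (- v) <= - q v].
Proof.
elim: s p => [|v s IH] p sp; first by exists p; split.
have [q1 [sq1 q1p q1v]] := sublinear_straighten v sp.
have [q [sq qq1 qs]] := IH _ sq1.
exists q; split=> // [x|u]; first exact: le_trans (q1p x).
rewrite inE => /predU1P[->|]; last exact: qs.
apply: le_trans (qq1 _) _; apply: le_trans q1v _; rewrite lerN2.
exact: le_trans (q1p _).
Qed.

End straighten.

(* Making p minimal along z, then along each basis vector, leaves a sublinear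
   function that is linear on the whole space. *)
Lemma hahn_banach_rV n (p : 'rV[R]_n -> R) (z : 'rV[R]_n) : sublinear p ->
  exists lam : 'I_n -> R, (forall x : 'rV[R]_n, \sum_i lam i * x 0 i <= p x) /\
    p z <= \sum_i lam i * z 0 i.
Proof.
move=> sp.
have [q1 [sq1 q1p q1z]] := sublinear_straighten z sp.
have [q [sq qq1 qe]] := sublinear_minorant [seq delta_mx 0 i | i <- enum 'I_n] sq1.
pose lam i := q (delta_mx 0 i).
have lam1 x : q x <= \sum_i lam i * x 0 i.
  rewrite [x in q x]row_sum_delta.
  elim/big_ind2 : _ => [|a b c d ab cd|i _]; first by rewrite sublinear0.
    by apply: le_trans (sq.1 _ _) _; exact: lerD.
  have [x0|x0|->] := ltgtP (x 0 i) 0.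
  - have -> : x 0 i *: delta_mx 0 i = (- x 0 i) *: (- delta_mx 0 i) :> 'rV[R]_n.
      by rewrite scaleNr scalerN opprK.
    apply: le_trans (sq.2 _ _ _) _; first by rewrite oppr_gt0.
    have : q (- delta_mx 0 i) <= - lam i by apply: qe; apply: map_f; rewrite mem_enum.
    nra.
  - by apply: le_trans (sq.2 _ _ x0) _; rewrite mulrC.
  - by rewrite scale0r mulr0 sublinear0.
(* The linear form lies above [q] everywhere; used at [- x], this puts it below [q] at [x]. *)
have lam2 (x : 'rV[R]_n) : \sum_i lam i * x 0 i <= q x.
  apply: le_trans (sublinear_opp x sq); rewrite lerNr.
  apply: le_trans (lam1 _) _; rewrite -sumrN; apply: ler_sum => i _.
  by rewrite mxE mulrN.
exists lam; split => [x|]; first exact: le_trans (lam2 x) (le_trans (qq1 x) (q1p x)).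
have := lam2 (- z); rewrite (eq_bigr (fun i => - (lam i * z 0 i))); last first.
  by move=> i _; rewrite mxE mulrN.
rewrite sumrN; have := qq1 (- z); lra.
Qed.

End hahn_banach.

(** * Integrals of decreasing functions over initial intervals *)

Section decreasing_integrals.
Context {R : realType}.
Local Notation mu := (@lebesgue_measure R).

Lemma integral_itv0_cst (c : \bar R) (x : R) : 0 <= x ->
  (\int[mu]_(t in itv0 x%:E) c = c * x%:E)%E.
Proof.
by have m := measurable_itv0 x%:E; move=> x0; rewrite integral_cst//; congr (_ * _)%E;
  apply: lebesgue_measure_itv0; rewrite lee_fin.
Qed.

Lemma integral_itv0_slope (F : R -> \bar R) (x y : R) : 0 < x -> x <= y ->
  measurable_fun (itv0 y%:E) F -> (forall t, itv0 y%:E t -> (0 <= F t)%E) ->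
  (forall s t, itv0 y%:E s -> itv0 y%:E t -> s <= t -> (F t <= F s)%E) ->
  (x%:E * \int[mu]_(t in itv0 y%:E) F t <= y%:E * \int[mu]_(t in itv0 x%:E) F t)%E.
Proof.
move=> x0; rewrite le_eqVlt => /predU1P[<-//|xy] mF F0 Fdec.
have y0 := lt_trans x0 xy.
pose B := itv0 y%:E `\` itv0 x%:E.
have mB : measurable B by apply: measurableD; exact: measurable_itv0.
have BE : B = [set` `[x, y[].
  apply/seteqP; split => t; rewrite /B /itv0/= in_itv/= !lte_fin.
    by move=> [[t0 ->]] /not_andP[//|/negP]; rewrite -leNgt => ->.
  move=> /andP[xt ty]; split; first by split=> //; exact: lt_le_trans xt.
  by move=> [_]; rewrite ltNge xt.
have muB : mu B = (y - x)%:E by rewrite BE lebesgue_measure_itv/= lte_fin xy EFinB.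
have Jx : itv0 y%:E x by split => //; rewrite lte_fin.
have I0 : (0 <= \int[mu]_(t in itv0 x%:E) F t)%E.
  by apply: integral_ge0 => t /(itv0S_mem Jx); exact: F0.
have xF : (x%:E * F x <= \int[mu]_(t in itv0 x%:E) F t)%E.
  rewrite muleC -(integral_itv0_cst (F x) (ltW x0)); apply: ge0_le_integral => //.
  - exact: measurable_itv0.
  - by move=> t _; exact: F0.
  - by apply: measurable_funS mF; [exact: measurable_itv0|exact: itv0S_mem].
  - move=> t xt; apply: Fdec => //; first exact: itv0S_mem xt.
    by case: xt => _ /ltW.
have FB : (\int[mu]_(t in B) F t <= F x * (y - x)%:E)%E.
  apply: (@le_trans _ _ (\int[mu]_(t in B) cst (F x) t)%E).
    apply: ge0_le_integral => //.
    - by move=> t [/F0].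
    - by apply: measurable_funS mF; [exact: measurable_itv0|move=> t []].
    - move=> t Bt; apply: Fdec => //; first by case: Bt.
      by move: Bt; rewrite BE /= in_itv/= => /andP[].
  by rewrite integral_cst// le_eqVlt; apply/orP; left; apply/eqP; congr (_ * _)%E; exact: muB.
have -> : itv0 y%:E = itv0 x%:E `|` B.
  by rewrite /B setDUK//; exact: itv0S_mem.
rewrite ge0_integral_setU//; first last.
- by apply/disj_setPS => t [? []].
- by rewrite /B setDUK//; exact: itv0S_mem.
- by rewrite /B setDUK//; exact: itv0S_mem.
- exact: measurable_itv0.
rewrite ge0_muleDr//; last by apply: integral_ge0 => t [/F0].
have -> : y%:E = (x%:E + (y - x)%:E)%E by rewrite -EFinD addrC subrK.
have yx0 : (0 <= (y - x)%:E)%E by rewrite lee_fin subr_ge0 ltW.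
have xe0 : (0 <= x%:E)%E by rewrite lee_fin ltW.
rewrite (ge0_muleDl _ xe0 yx0); apply: leeD2l.
apply: (@le_trans _ _ (x%:E * (F x * (y - x)%:E))%E).
  exact: lee_wpmul2l.
by rewrite muleA muleC; exact: lee_wpmul2l.
Qed.

Lemma ae_on_indic0 (D A : set R) : measurable A -> A `<=` D ->
  ae_on D (fun x => (\1_A x : R) = 0) -> mu A = 0%E.
Proof.
move=> mA AD Dae; apply/negligibleP => //; apply: negligibleS Dae.
move=> x Ax /= /(_ (AD _ Ax)); rewrite indicE mem_set//; apply/eqP; exact: oner_neq0.
Qed.

(** Hardy-Littlewood against the indicator of [(0, x)], whose rearrangement is at most itself. *)
Lemma integral_abs_le_star (l : \bar R) (e : R -> R) (x : R) : (0 <= l)%E ->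
  measurable_fun (itv0 l) e -> itv0 l x ->
  (\int[mu]_(t in itv0 x%:E) `|e t|%:E <= \int[mu]_(t in itv0 x%:E) star (itv0 l) e t)%E.
Proof.
move=> l0 me lx; have mJ := measurable_itv0 l; have mx := measurable_itv0 x%:E.
have xJ := itv0S_mem lx; have m1 : measurable_fun (itv0 l) (\1_(itv0 x%:E) : R -> R).
  exact: measurable_indic.
have := hardy_littlewood_star mJ me m1; rewrite lebesgue_measure_itv0//.
under eq_integral do rewrite normrM (@ger0_norm _ (\1__ _))// EFinM muleC.
rewrite integral_indic_mul// => /le_trans; apply.
rewrite -[leRHS](integral_indic_mul _ xJ); apply: ge0_le_integral => //.
- by move=> t _; apply: mule_ge0; exact: star_ge0.
- by apply: emeasurable_funM; exact: measurable_star.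
- apply: emeasurable_funM; last exact: measurable_star.
  by apply/measurable_EFinP; exact: measurable_indic.
- move=> t Jt; rewrite muleC; apply: lee_wpmul2r; first exact: star_ge0.
  have t0 : 0 < t by case: Jt.
  have := @star_le_steps _ _ mJ 1 (fun=> itv0 x%:E) (fun=> x) (fun=> 1) 0 t _ m1.
  rewrite !big_ord1 add0r !mul1r => /(_ _ _ _ _ _ (ltW t0) _).
  have -> : (\1_(itv0 x%:E) t) = (t < x)%R%:R :> R.
    rewrite indicE; congr (nat_of_bool _)%:R; apply/idP/idP; rewrite inE; first by case.
    by move=> tx; split.
  apply=> //.
  + by move=> i j _ _.
  + by move=> i _; rewrite lebesgue_measure_itv0// lee_fin; case: lx => /ltW.
  + by move=> y _; rewrite big_ord1 add0r mul1r ger0_norm.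
Qed.

End decreasing_integrals.

(** * Elementary properties of a fully symmetric space *)

Section rearrangement_invariant_space.
Context {R : realType} (b : \bar R) (E : fun_space R).
Local Notation mu := (@lebesgue_measure R).
Local Notation J := (itv0 b).
Hypotheses (b0 : (0 < b)%E) (bfsE : banach_function_space J E)
  (fsE : fully_symmetric b E) (suppE : has_support J E).

Let mJ : measurable J. Proof. exact: measurable_itv0. Qed.

Lemma carrier_measurable f : carrier E f -> measurable_fun J f.
Proof. by case: bfsE => -[+ _ _ _] _ _ _; apply. Qed.

Lemma carrierDZ (c : R) f g : carrier E f -> carrier E g ->
  carrier E (fun x => c * f x + g x).
Proof. by case: bfsE => -[_ _ + _] _ _ _; apply. Qed.

Lemma carrier0 : carrier E (cst 0).
Proof. by case: bfsE => -[]. Qed.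

Lemma carrier_solid f g : measurable_fun J f -> carrier E g -> ae_dominated J f g ->
  carrier E f.
Proof. by case: bfsE => -[_ _ _ +] _ _ _; apply. Qed.

Lemma carrierZ (c : R) f : carrier E f -> carrier E (fun x => c * f x).
Proof.
move=> Ef; have := carrierDZ c Ef carrier0.
by congr carrier; apply/funext => x /=; rewrite addr0.
Qed.

Lemma carrierD f g : carrier E f -> carrier E g -> carrier E (fun x => f x + g x).
Proof.
move=> Ef Eg; have := carrierDZ 1 Ef Eg.
by congr carrier; apply/funext => x /=; rewrite mul1r.
Qed.

Lemma gauge_eq0 f : carrier E f -> (gauge E f = 0 <-> ae_on J (fun x => f x = 0)).
Proof. by case: bfsE => _ _ [+ _ _ _] _; apply. Qed.

Lemma gaugeZ (c : R) f : carrier E f -> gauge E (fun x => c * f x) = `|c| * gauge E f.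
Proof. by case: bfsE => _ _ [_ + _ _] _; apply. Qed.

Lemma gaugeD f g : carrier E f -> carrier E g ->
  gauge E (fun x => f x + g x) <= gauge E f + gauge E g.
Proof. by case: bfsE => _ _ [_ _ + _] _; apply. Qed.

Lemma gauge_le f g : carrier E f -> carrier E g -> ae_dominated J f g ->
  gauge E f <= gauge E g.
Proof. by case: bfsE => _ _ [_ _ _ +] _; apply. Qed.

Lemma gauge0 : gauge E (cst 0) = 0.
Proof. by apply/(gauge_eq0 carrier0); exact: ae_onT. Qed.

Lemma gauge_ge0 f : carrier E f -> 0 <= gauge E f.
Proof.
move=> Ef; rewrite -gauge0; apply: gauge_le => //; first exact: carrier0.
by apply: ae_onT => x _; rewrite normr0.
Qed.

Lemma carrier_indic x : J x -> carrier E (\1_(itv0 x%:E) : R -> R).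
Proof.
move=> Jx; apply: suppE; [exact: measurable_itv0|exact: itv0S_mem|].
by rewrite lebesgue_measure_itv0 ?ltry// lee_fin; case: Jx => /ltW.
Qed.

Lemma gauge_indic_gt0 x : J x -> 0 < gauge E (\1_(itv0 x%:E) : R -> R).
Proof.
move=> Jx; have Ex := carrier_indic Jx; rewrite lt_neqAle gauge_ge0// andbT.
apply/eqP => /esym/(gauge_eq0 Ex)/ae_on_indic0 => /(_ (measurable_itv0 _) (itv0S_mem Jx)).
have [x0 _] := Jx; rewrite lebesgue_measure_itv0 ?lee_fin ?ltW// => -[]/eqP.
by rewrite gt_eqF.
Qed.

(** If the integral were infinite for one [x], the slope inequality would make it infinite for all.
    Then [e] would submajorize every multiple of an indicator, whose gauges are unbounded. *)
Lemma integral_star_lty e x : carrier E e -> J x ->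
  (\int[mu]_(t in itv0 x%:E) star J e t < +oo)%E.
Proof.
move=> Ee Jx; rewrite ltey; apply/eqP => xoo.
have yoo y : J y -> (\int[mu]_(t in itv0 y%:E) star J e t = +oo)%E.
  move=> Jy; have [x0 _] := Jx; have [y0 _] := Jy.
  have [xy|yx] := leP x y.
    apply/eqP; rewrite -leye_eq -xoo; apply: ge0_subset_integral.
    - exact: measurable_itv0.
    - exact: measurable_itv0.
    - by apply: measurable_star; exact: measurable_itv0.
    - by move=> *; exact: star_ge0.
    - by apply: itv0S; rewrite lee_fin.
  have := @integral_itv0_slope _ (star J e) y x y0 (ltW yx)
    (measurable_star _ _ (measurable_itv0 _)) (fun t _ => star_ge0 _ _ _)
    (fun s t _ _ st => star_nonincreasing _ _ st).
  rewrite xoo gt0_muley ?lte_fin// leye_eq.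
  case: (\int[mu]_(t in itv0 y%:E) _)%E => //.
  by rewrite gt0_muleNy ?lte_fin.
have Ex := carrier_indic Jx.
have le n : n%:R * gauge E (\1_(itv0 x%:E) : R -> R) <= gauge E e.
  rewrite -[n%:R]normr_nat -gaugeZ//.
  apply: (fsE.2 _ _ _ Ee _).2; first exact: carrier_measurable (carrierZ _ Ex).
  by move=> y Jy; rewrite yoo// leey.
have := archi_boundP (divr_ge0 (gauge_ge0 Ee) (ltW (gauge_indic_gt0 Jx))).
rewrite ltr_pdivrMr ?gauge_indic_gt0// => /lt_le_trans/(_ (le _)).
by rewrite ltxx.
Qed.

Lemma star_lty e t : carrier E e -> J t -> (star J e t < +oo)%E.
Proof.
move=> Ee Jt; have := integral_star_lty Ee Jt; rewrite !ltey; apply: contra => /eqP too.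
have t0 : 0 < t by case: Jt.
have := @ge0_le_integral _ _ _ mu (itv0 t%:E) (measurable_itv0 _) (cst +oo%E) (star J e)
  (fun _ _ => le0y) (measurable_cst _) (measurable_star _ _ (measurable_itv0 _)).
have := integral_itv0_cst +oo%E (ltW t0); rewrite gt0_mulye ?lte_fin// => /= ->.
rewrite leye_eq; apply => s [_].
rewrite lte_fin => /ltW st; rewrite -too; exact: star_nonincreasing.
Qed.

Lemma star_fin_num e t : carrier E e -> J t -> star J e t \is a fin_num.
Proof. by move=> Ee Jt; rewrite ge0_fin_numE ?star_ge0// star_lty. Qed.

(** The superlevel sets of [star J e] at nonnegative levels are the initial intervals with the
    measures of those of [e]; at negative levels both are all of [J]. Hence the two functions are
    equimeasurable. *)
Lemma carrier_star e : carrier E e ->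
  carrier E (fine \o star J e) /\ gauge E (fine \o star J e) = gauge E e.
Proof.
move=> Ee; have me := carrier_measurable Ee.
have mfs : measurable_fun J (fine \o star J e).
  by apply: measurableT_comp => //; exact: measurable_star.
suff /(fsE.1 _ _ Ee mfs)[? ->] : equimeasurable J e (fine \o star J e) by [].
move=> s; have [s0|s0] := ltP s 0.
  rewrite /distribution_fun; congr (mu _); apply/seteqP; split => t [Jt /= st];
    by split => //=; exact: lt_le_trans s0 _.
have dJ : (distribution_fun mu J e s <= b)%E.
  rewrite -[leRHS](lebesgue_measure_itv0 (ltW b0)).
  apply: le_measure; rewrite ?inE//; exact: measurable_superlevel.
rewrite [RHS](_ : _ = mu (itv0 (distribution_fun mu J e s))).
  by rewrite lebesgue_measure_itv0.
congr (mu _); apply/seteqP; split => t.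
  move=> [Jt /=]; rewrite ger0_norm ?fine_ge0 ?star_ge0// -lte_fin fineK ?star_fin_num//.
  by rewrite star_gtP//; split => //; case: Jt.
move=> [t0 td]; have Jt : J t by split => //; exact: lt_le_trans dJ.
split=> //=; rewrite ger0_norm ?fine_ge0 ?star_ge0// -lte_fin fineK ?star_fin_num//.
by rewrite star_gtP.
Qed.

End rearrangement_invariant_space.

(** * Step functions in the unit ball of the dual of [E] *)

Section dual_weights.
Context {R : realType} (b : \bar R) (E : fun_space R).
Local Notation mu := (@lebesgue_measure R).
Local Notation J := (itv0 b).
Hypotheses (b0 : (0 < b)%E) (bfsE : banach_function_space J E)
  (fsE : fully_symmetric b E) (suppE : has_support J E).

Let mJ : measurable J. Proof. exact: measurable_itv0. Qed.

(** The convex cone over which the Hahn-Banach infimum is taken. Monotonicity gives the primitives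
    decreasing means, so that their values at finitely many points carry enough information. *)
Definition decreasing_in (g : R -> R) : Prop :=
  [/\ carrier E g, forall t, J t -> 0 <= g t &
      forall s t, J s -> J t -> s <= t -> g t <= g s].

Definition primitive (g : R -> R) (x : R) : R :=
  fine (\int[mu]_(t in itv0 x%:E) (g t)%:E)%E.

Lemma decreasing_in_star e : carrier E e -> decreasing_in (fine \o star J e).
Proof.
move=> Ee; split; first exact: (carrier_star b0 bfsE fsE suppE Ee).1.
  by move=> t _ /=; rewrite fine_ge0// star_ge0.
move=> s t Js Jt st /=; apply: fine_le; rewrite ?(star_fin_num bfsE fsE suppE)//.
exact: star_nonincreasing.
Qed.

Lemma decreasing_inD f g : decreasing_in f -> decreasing_in g ->
  decreasing_in (fun t => f t + g t).
Proof.
move=> [Ef f0 fd] [Eg g0 gd]; split; first exact: carrierD bfsE _ _ Ef Eg.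
  by move=> t Jt; rewrite addr_ge0// ?f0 ?g0.
by move=> s t Js Jt st; rewrite lerD ?fd ?gd.
Qed.

Lemma decreasing_inZ c g : 0 <= c -> decreasing_in g -> decreasing_in (fun t => c * g t).
Proof.
move=> c0 [Eg g0 gd]; split; first exact: carrierZ bfsE _ _ Eg.
  by move=> t Jt; rewrite mulr_ge0// g0.
by move=> s t Js Jt st; rewrite ler_wpM2l ?gd.
Qed.

Lemma decreasing_in_indic x : J x -> decreasing_in (\1_(itv0 x%:E)).
Proof.
move=> Jx; split; first exact: carrier_indic suppE _ Jx.
  by move=> t _; rewrite indicE.
move=> s t [s0 _] _ st; rewrite [in leLHS]indicE; case: (boolP (t \in _)) => [|_];
  last by rewrite indicE.
rewrite inE => -[t0 tx]; rewrite indicE mem_set//; split=> //.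
by apply: le_lt_trans tx; rewrite lee_fin.
Qed.

Let measurable_dec g x : decreasing_in g -> J x ->
  measurable_fun (itv0 x%:E) (fun t => (g t)%:E).
Proof.
move=> [Eg _ _] Jx; apply/measurable_EFinP.
apply: measurable_funS (carrier_measurable bfsE Eg) => //; exact: itv0S_mem.
Qed.

Lemma primitiveE g x : decreasing_in g -> J x ->
  (\int[mu]_(t in itv0 x%:E) (g t)%:E = (primitive g x)%:E)%E.
Proof.
move=> dg Jx; have [Eg g0 _] := dg; rewrite /primitive fineK// ge0_fin_numE; last first.
  by apply: integral_ge0 => t /(itv0S_mem Jx) Jt; rewrite lee_fin g0.
apply: le_lt_trans (integral_star_lty bfsE fsE suppE Eg Jx).
apply: le_trans (integral_abs_le_star (ltW b0) (carrier_measurable bfsE Eg) Jx).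
rewrite le_eqVlt; apply/orP; left; apply/eqP; apply: eq_integral => t.
by rewrite inE => /(itv0S_mem Jx) Jt; rewrite ger0_norm// g0.
Qed.

Lemma primitive_ge0 g x : decreasing_in g -> J x -> 0 <= primitive g x.
Proof.
move=> [_ g0 _] Jx; apply: fine_ge0; apply: integral_ge0 => t /(itv0S_mem Jx) Jt.
by rewrite lee_fin g0.
Qed.

Lemma primitiveD f g x : decreasing_in f -> decreasing_in g -> J x ->
  primitive (fun t => f t + g t) x = primitive f x + primitive g x.
Proof.
move=> df dg Jx; apply: EFin_inj; rewrite EFinD -!primitiveE//; last exact: decreasing_inD.
rewrite -ge0_integralD//; try exact: measurable_dec.
- exact: measurable_itv0.
- by move=> t /(itv0S_mem Jx) Jt; rewrite lee_fin; case: df => _ + _; apply.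
- by move=> t /(itv0S_mem Jx) Jt; rewrite lee_fin; case: dg => _ + _; apply.
Qed.

Lemma primitiveZ c g x : 0 <= c -> decreasing_in g -> J x ->
  primitive (fun t => c * g t) x = c * primitive g x.
Proof.
move=> c0 dg Jx; apply: EFin_inj; rewrite EFinM -!primitiveE//; last exact: decreasing_inZ.
rewrite -ge0_integralZl_EFin//; try exact: measurable_dec.
  exact: measurable_itv0.
by move=> t /(itv0S_mem Jx) Jt; rewrite lee_fin; case: dg => _ + _; apply.
Qed.

Lemma primitive_indic x y : 0 < x -> x <= y -> primitive (\1_(itv0 y%:E)) x = x.
Proof.
move=> x0 xy; rewrite /primitive integral_indic; [|exact: measurable_itv0..].
suff E0 : mu (itv0 y%:E `&` itv0 x%:E) = x%:E by transitivity (fine x%:E); [congr fine; exact: E0|].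
rewrite (setIidr (itv0S _)); last by rewrite lee_fin.
by rewrite lebesgue_measure_itv0// lee_fin ltW.
Qed.

Lemma primitive_slope g x y : decreasing_in g -> J y -> 0 < x -> x <= y ->
  x * primitive g y <= y * primitive g x.
Proof.
move=> dg Jy x0 xy; have Jx : J x by exact: itv0_le Jy _ _.
rewrite -lee_fin !EFinM -!primitiveE//; have [Eg g0 gd] := dg.
have yJ := itv0S_mem Jy.
apply: integral_itv0_slope => //; first exact: measurable_dec.
- by move=> t /yJ Jt; rewrite lee_fin g0.
- by move=> s t /yJ Js /yJ Jt st; rewrite lee_fin gd.
Qed.

Lemma primitive_nondecreasing g x y : decreasing_in g -> J y -> 0 < x -> x <= y ->
  primitive g x <= primitive g y.
Proof.
move=> dg Jy x0 xy; have Jx : J x by exact: itv0_le Jy _ _.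
rewrite -lee_fin -!primitiveE//; have [Eg g0 gd] := dg.
apply: ge0_subset_integral; [exact: measurable_itv0|exact: measurable_itv0| | |].
- exact: measurable_dec.
- by move=> t /(itv0S_mem Jy) Jt; rewrite lee_fin g0.
- by apply: itv0S; rewrite lee_fin.
Qed.

(* The Hahn-Banach theorem for the sublinear function mapping v to the infimum
   of the gauges of the decreasing g in E with v i <= primitive g (x i). With
   the lam i obtained, \sum_i lam i * \1_(0, x i) lies in the unit ball of E'. *)
Lemma dual_weights n (x z : 'I_n -> R) (rho : R) : (forall i, J (x i)) ->
  (forall g, decreasing_in g -> (forall i, z i <= primitive g (x i)) -> rho <= gauge E g) ->
  exists lam : 'I_n -> R, [/\ forall i, 0 <= lam i, rho <= \sum_i lam i * z i &
    forall g, decreasing_in g -> \sum_i lam i * primitive g (x i) <= gauge E g].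
Proof.
move=> Jx rhoP.
have x0 i : 0 < x i by case: (Jx i).
have ge0E := gauge_ge0 bfsE.
pose G (v : 'rV[R]_n) := [set g | decreasing_in g /\ forall i, v 0 i <= primitive g (x i)].
pose S v := gauge E @` G v.
have S0 v : S v !=set0.
  have [y Jy] : exists y, J y.
    case: (b) b0 => [r| |] //; last by exists 1; split=> //; rewrite ltry.
    by rewrite lte_fin => r0; exists (r / 2); split; [lra|rewrite lte_fin; lra].
  (* Starting the maximum at [y] keeps [X] in [J] even when [n = 0]. *)
  have [X JX xX] : exists2 X, J X & forall i, x i <= X.
    exists (\big[Num.max/y]_i x i) => [|i]; last exact: le_bigmax.
    by elim/big_ind : _ => // u v' Ju Jv'; rewrite /Num.max; case: ifP.
  (* The primitive of [c * \1_(0, X)] at [x i] is [c * x i], which is at least [|v 0 i|]. *)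
  pose c := \sum_i `|v 0 i| / x i.
  have c0 : 0 <= c by apply: sumr_ge0 => i _; rewrite divr_ge0// ltW.
  exists (gauge E (fun t => c * \1_(itv0 X%:E) t)).
  exists (fun t => c * \1_(itv0 X%:E) t) => //; split.
    by apply: decreasing_inZ => //; exact: decreasing_in_indic.
  move=> i; rewrite primitiveZ//; last exact: decreasing_in_indic.
  rewrite primitive_indic// /c (bigD1 i)//= mulrDl divfK ?gt_eqF//.
  apply: le_trans (ler_norm _) _; rewrite lerDl; apply: mulr_ge0; last exact: ltW.
  by apply: sumr_ge0 => j _; rewrite divr_ge0// ltW.
have lbS v : lbound (S v) 0 by move=> _ [g [[Eg _ _] _] <-]; exact: ge0E.
have infS v s : S v s -> inf (S v) <= s by move=> Ss; apply: ge_inf => //; exists 0.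
pose p v := inf (S v).
have sp : sublinear p.
  split=> [u v|t v t0].
    rewrite -lerBlDr; apply: lb_le_inf => // _ [f [df fu] <-].
    rewrite lerBlDl -lerBlDr; apply: lb_le_inf => // _ [g [dg gv] <-].
    have Ef : carrier E f by case: df.
    have Eg : carrier E g by case: dg.
    rewrite lerBlDr addrC; apply: le_trans (gaugeD bfsE Eg Ef).
    apply: infS; exists (fun t => g t + f t) => //; split; first exact: decreasing_inD.
    by move=> i; rewrite mxE primitiveD// lerD.
  rewrite -ler_pdivrMl//; apply: lb_le_inf => // _ [f [df fu] <-].
  have Ef : carrier E f by case: df.
  rewrite ler_pdivrMl// -[t in leRHS](gtr0_norm t0) -(gaugeZ bfsE)//.
  apply: infS; exists (fun s => t * f s) => //; split; first exact: decreasing_inZ (ltW t0) df.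
  by move=> i; rewrite mxE (primitiveZ (ltW t0))// ler_pM2l.
have [lam [lamp lamz]] := hahn_banach_rV (\row_i z i) sp.
exists lam; split.
(* For minus a unit vector the zero function is admissible, so [p] is at most 0 there; this gives
   [0 <= lam i]. *)
- move=> i; have := lamp (- delta_mx 0 i).
  rewrite (bigD1 i)//= big1 ?addr0 => [|j ji]; last first.
    by rewrite !mxE (negPf ji) andbF oppr0 mulr0.
  rewrite !mxE !eqxx mulrN1 => /le_trans lei; rewrite -oppr_le0; apply: lei.
  rewrite -(gauge0 bfsE); apply: infS; exists (cst 0) => //; split.
    by split=> //; exact: carrier0 bfsE.
  move=> j; rewrite !mxE; apply: (@le_trans _ _ 0); first by rewrite oppr_le0.
  by apply: fine_ge0; apply: integral_ge0.
- apply: le_trans (_ : _ <= p (\row_i z i)) _; last first.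
    by apply: le_trans lamz _; apply: ler_sum => i _; rewrite mxE.
  apply: lb_le_inf => // _ [g [dg gz] <-]; apply: rhoP => // i.
  by have := gz i; rewrite mxE.
- move=> g dg; apply: (@le_trans _ _ (p (\row_i primitive g (x i)))).
    by apply: le_trans (lamp _); apply: ler_sum => i _; rewrite mxE.
  by apply: infS; exists g => //; split=> // i; rewrite mxE.
Qed.

(** Normalizing [e] reduces this to the definition of the dual norm; when its gauge is 0, [e]
    vanishes a.e. instead. *)
Lemma kothe_holder (h e : R -> R) : carrier E e -> measurable_fun J h ->
  (kothe_sup J E h < +oo)%E ->
  (\int[mu]_(t in J) `|h t * e t|%:E <= (gauge E e * fine (kothe_sup J E h))%:E)%E.
Proof.
move=> Ee mh hoo; have me := carrier_measurable bfsE Ee.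
have ub g : carrier E g -> gauge E g <= 1 ->
    (\int[mu]_(t in J) `|h t * g t|%:E <= kothe_sup J E h)%E.
  by move=> Eg g1; apply: ereal_sup_ubound; exists g.
have Kfin : kothe_sup J E h \is a fin_num.
  rewrite ge0_fin_numE//; apply: le_trans (ub _ (carrier0 bfsE) _).
    by apply: integral_ge0 => t _; rewrite lee_fin.
  by rewrite (gauge0 bfsE).
have := gauge_ge0 bfsE Ee; rewrite le_eqVlt => /predU1P[/esym e0|e0].
  rewrite e0 mul0r; have /(gauge_eq0 bfsE Ee) ae0 := e0.
  rewrite (ge0_ae_eq_integral (g := cst 0%E))//; first by rewrite integral0.
  - by apply/measurable_EFinP; apply: measurableT_comp => //; exact: measurable_funM.
  - by apply: ae_onW ae0 => t Jt ->; rewrite mulr0 normr0.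
have e1 := carrierZ bfsE (gauge E e)^-1 Ee.
have := ub _ e1; rewrite (gaugeZ bfsE)// gtr0_norm ?invr_gt0// mulVf ?gt_eqF//.
move=> /(_ (lexx _)) le1.
rewrite EFinM fineK// -lee_pdivrMl// -ge0_integralZl_EFin//.
- apply: le_trans le1; rewrite le_eqVlt; apply/orP; left; apply/eqP.
  apply: eq_integral => t _; rewrite -EFinM; congr EFin.
  by rewrite mulrCA [RHS]normrM gtr0_norm ?invr_gt0.
- by apply/measurable_EFinP; apply: measurableT_comp => //; exact: measurable_funM.
- by rewrite invr_ge0 ltW.
Qed.

(** For [e] in the unit ball, the integral of [|e|] over [(0, x i)] is at most the primitive of its
    rearrangement. The latter belongs to the cone and has the same gauge as [e], so the hypothesis
    on [lam] applies to it. *)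
Lemma kothe_sup_steps n (x lam : 'I_n -> R) (h : R -> R) : (forall i, J (x i)) ->
  (forall i, 0 <= lam i) ->
  (forall g, decreasing_in g -> \sum_i lam i * primitive g (x i) <= gauge E g) ->
  measurable_fun J h ->
  (forall t, J t -> `|h t| <= \sum_i lam i * (t < x i)%R%:R) ->
  (kothe_sup J E h <= 1)%E.
Proof.
move=> Jx lam0 lamE mh hle; apply: ge_ereal_sup => _ [e [Ee e1] <-].
have me := carrier_measurable bfsE Ee.
apply: (@le_trans _ _ (\int[mu]_(t in J)
    (\sum_i (lam i)%:E * ((\1_(itv0 (x i)%:E) t)%:E * `|e t|%:E)))%E).
  apply: ge0_le_integral => //.
  - by apply/measurable_EFinP; apply: measurableT_comp => //; exact: measurable_funM.
  - apply: emeasurable_sum => i; apply: emeasurable_funM; first exact: measurable_cst.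
    apply: emeasurable_funM; apply/measurable_EFinP.
      by apply: measurable_indic; exact: measurable_itv0.
    by apply: measurableT_comp.
  - move=> t Jt; under eq_bigr do rewrite -!EFinM; rewrite sumEFin lee_fin normrM.
    under eq_bigr do rewrite mulrA; rewrite -mulr_suml ler_wpM2r//.
    apply: le_trans (hle _ Jt) _; apply: ler_sum => i _; rewrite ler_wpM2l//.
    by case: ltP => // tx; rewrite indicE mem_set//; split=> //; case: Jt.
rewrite ge0_integral_sum//; first last.
- by move=> i t Jt; rewrite !mule_ge0 ?lee_fin.
- move=> i; apply: emeasurable_funM; first exact: measurable_cst.
  apply: emeasurable_funM; apply/measurable_EFinP.
    by apply: measurable_indic; exact: measurable_itv0.
  by apply: measurableT_comp.
have [Es gs] := carrier_star b0 bfsE fsE suppE Ee.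
apply: (@le_trans _ _ (\sum_i (lam i)%:E * (primitive (fine \o star J e) (x i))%:E)%E).
  apply: lee_sum => i _; rewrite ge0_integralZl_EFin//.
  - apply: lee_wpmul2l; first by rewrite lee_fin.
    rewrite (integral_indic_mul _ (itv0S_mem (Jx i))).
    apply: le_trans (integral_abs_le_star (ltW b0) me (Jx i)) _.
    rewrite -primitiveE//; last exact: decreasing_in_star.
    rewrite le_eqVlt; apply/orP; left; apply/eqP; apply: eq_integral => t.
    by rewrite inE => /(itv0S_mem (Jx i)) Jt; rewrite /= fineK// (star_fin_num bfsE fsE suppE).
  - apply: emeasurable_funM; apply/measurable_EFinP.
      by apply: measurable_indic; exact: measurable_itv0.
    by apply: measurableT_comp.
under eq_bigr do rewrite -EFinM; rewrite sumEFin lee_fin.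
apply: le_trans (lamE _ (decreasing_in_star Ee)) _.
by rewrite gs.
Qed.

End dual_weights.

(** * Sets of prescribed Lebesgue measure *)

Section nonatomic.
Context {R : realType}.
Local Notation mu := (@lebesgue_measure R).

(** The measure of the union of [A] and the part of [B] below [y] is 1-Lipschitz in [y], equals
    [mu A] for [y <= 0] and tends to [mu B], possibly infinite. The intermediate value theorem
    yields the set. *)
Lemma lebesgue_intermediate_set (A B : set R) (t : R) : measurable A -> measurable B ->
  A `<=` B -> (forall x, B x -> 0 < x) -> (mu A <= t%:E)%E -> (t%:E <= mu B)%E ->
  exists C, [/\ measurable C, A `<=` C, C `<=` B & mu C = t%:E].
Proof.
move=> mA mB AB B0 At; rewrite le_eqVlt => /predU1P[tB|tB]; first by exists B; split.
pose L (y : R) := [set x : R | x < y].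
have mL y : measurable (L y).
  by rewrite (_ : L y = `]-oo, y[%classic)//; apply/seteqP; split => x /=; rewrite in_itv.
pose S y := A `|` (B `&` L y).
have mS y : measurable (S y) by apply: measurableU => //; exact: measurableI.
have SS y z : y <= z -> S y `<=` S z.
  by move=> yz x [Ax|[Bx xy]]; [left|right; split => //; exact: lt_le_trans yz].
have Sadd y z : 0 <= y -> y <= z -> (mu (S z) <= mu (S y) + (z - y)%:E)%E.
  move=> y0 yz; have mi : measurable (`[y, z]%classic : set R) by exact: measurable_itv.
  apply: (@le_trans _ _ (mu (S y `|` `[y, z]%classic))).
    apply: le_measure; rewrite ?inE; [exact: mS|exact: (measurableU _ _ (mS y) mi)|].
    move=> x [Ax|[Bx xz]]; first by left; left.
    have [xy|yx] := ltP x y; first by left; right.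
    by right; rewrite /= in_itv/= yx ltW.
  have le2 : (mu (S y `|` `[y, z]%classic) <= mu (S y) + mu `[y, z]%classic)%E.
    by apply: measureU2; [exact: mS|exact: mi].
  apply: le_trans le2 _; apply: leeD2l.
  rewrite lebesgue_measure_itv/= lte_fin; case: ifPn => [_|_]; first by rewrite -EFinB.
  by rewrite lee_fin subr_ge0.
have S0 y : y <= 0 -> S y = A.
  move=> y0; apply/seteqP; split => x; last by left.
  by case=> // -[/B0 x0 xy]; have := lt_trans x0 (lt_le_trans xy y0); rewrite ltxx.
have Sfin y : mu (S y) \is a fin_num.
  rewrite ge0_fin_numE//; have [y0|/ltW y0] := leP y 0.
    by rewrite S0//; apply: le_lt_trans At _; rewrite ltry.
  apply: le_lt_trans (Sadd 0 y (lexx _) y0) _; rewrite S0//.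
  apply: lte_add_pinfty; last by rewrite ltry.
  by apply: le_lt_trans At _; rewrite ltry.
pose f y := fine (mu (S y)).
have fE y : mu (S y) = (f y)%:E by rewrite fineK.
have fle y z : y <= z -> f y <= f z.
  by move=> yz; rewrite -lee_fin -!fE; apply: le_measure; rewrite ?inE;
    [exact: mS|exact: mS|exact: SS].
have flip y z : y <= z -> f z <= f y + (z - y).
  move=> yz; have [z0|z0] := leP z 0.
    by rewrite /f !S0// ?(le_trans yz)// lerDl subr_ge0.
  have [y0|/ltW y0] := leP y 0.
    have := Sadd 0 z (lexx _) (ltW z0); rewrite !fE -EFinD lee_fin.
    by have -> : f y = f 0; [rewrite /f !S0|lra].
  by have := Sadd y z y0 yz; rewrite !fE -EFinD lee_fin.
have [n tn] : exists n : nat, t < f n%:R.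
  have BS : B = \bigcup_n S n%:R.
    apply/seteqP; split => [x Bx|x [n _ [/AB//|[]//]]].
    exists (Num.bound x) => //; right; split=> //.
    by apply: archi_boundP; exact: ltW (B0 _ Bx).
  have c : (mu \o (fun n : nat => S n%:R)) @ \oo --> mu (\bigcup_n S n%:R).
    apply: nondecreasing_cvg_mu; [by move=> i; exact: mS|by rewrite -BS|].
    by move=> i j ij; apply/subsetPset; apply: SS; rewrite ler_nat.
  apply: contrapT => /forallNP H; move: tB; rewrite BS -(cvg_lim _ c)// ltNge => /negP; apply.
  apply: lime_le; first by apply/cvg_ex; eexists; exact: c.
  by apply: nearW => n /=; rewrite fE lee_fin leNgt; apply/negP/H.
have cf : continuous f.
  move=> y; apply/cvgrPdist_lt => e e0; near=> z.
  have : `|y - z| < e by near: z; apply: cvgr_dist_lt => //; exact: cvg_id.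
  have [yz|/ltW zy] := leP y z.
    rewrite (distrC y) (distrC (f y)) !ger0_norm ?subr_ge0 ?fle// => /(le_lt_trans _); apply.
    by rewrite lerBlDl; exact: flip.
  rewrite !ger0_norm ?subr_ge0 ?fle// => /(le_lt_trans _); apply.
  by rewrite lerBlDl; exact: flip.
have [y _ fy] : exists2 c, c \in `[0, n%:R] & f c = t.
  apply: IVT => //; first exact: continuous_subspaceT.
  have f0 : f 0 <= t by rewrite -lee_fin -fE S0.
  by rewrite ge_min f0/= le_max (ltW tn) orbT.
exists (S y); split => //; [by move=> x; left|by move=> x [/AB|[]]|by rewrite fE fy].
Unshelve. all: by end_near. Qed.

(** Each new set is chosen between the previous one, called [P] and empty at the start, and
    [B n]. *)
Lemma lebesgue_nested_sets n (B : nat -> set R) (tau : nat -> R) :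
  (forall i, (i < n)%N -> measurable (B i)) ->
  (forall i, (i < n)%N -> forall x, B i x -> 0 < x) ->
  (forall i j, (i <= j)%N -> (j < n)%N -> B i `<=` B j) ->
  (forall i, (i < n)%N -> 0 <= tau i) ->
  (forall i j, (i <= j)%N -> (j < n)%N -> tau i <= tau j) ->
  (forall i, (i < n)%N -> ((tau i)%:E <= mu (B i))%E) ->
  exists A : nat -> set R, [/\ forall i, (i < n)%N -> measurable (A i),
    forall i, (i < n)%N -> A i `<=` B i,
    forall i, (i < n)%N -> mu (A i) = (tau i)%:E &
    forall i j, (i <= j)%N -> (j < n)%N -> A i `<=` A j].
Proof.
elim: n => [|n IH] mB B0 BS tau0 tauS tauB; first by exists (fun=> set0).
have nn i : (i < n)%N -> (i < n.+1)%N by move=> /ltnW.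
have [A [mA AB muA AS]] : exists A : nat -> set R,
    [/\ forall i, (i < n)%N -> measurable (A i),
    forall i, (i < n)%N -> A i `<=` B i,
    forall i, (i < n)%N -> mu (A i) = (tau i)%:E &
    forall i j, (i <= j)%N -> (j < n)%N -> A i `<=` A j].
  apply: IH; [by move=> i /nn /mB|by move=> i /nn /B0|by move=> i j ij /nn /(BS _ _ ij)|
    by move=> i /nn /tau0|by move=> i j ij /nn /(tauS _ _ ij)|by move=> i /nn /tauB].
pose P := if n is m.+1 then A m else set0.
have AP i : (i < n)%N -> A i `<=` P.
  by rewrite /P; case: (n) AS => // m AS im; apply: AS.
have [C [mC PC CB muC]] : exists C,
    [/\ measurable C, P `<=` C, C `<=` B n & mu C = (tau n)%:E].
  apply: lebesgue_intermediate_set.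
  - by rewrite /P; case: (n) mA => // m mA; exact: mA.
  - exact: mB.
  - rewrite /P; case: (n) AB BS => [_ _ x []|m AB BS x /(AB _ (ltnSn _))]; exact: BS.
  - exact: B0.
  - rewrite /P; case: (n) muA tauS tau0 => [_ _ tau0|m muA tauS _].
      by rewrite measure0 lee_fin tau0.
    by rewrite muA// lee_fin tauS.
  - exact: tauB.
exists (fun i => if (i < n)%N then A i else C); split.
- by move=> i _; case: ifPn => // /mA.
- move=> i; rewrite ltnS leq_eqVlt => /predU1P[->|ni]; first by rewrite ltnn.
  by rewrite ni; exact: AB.
- move=> i; rewrite ltnS leq_eqVlt => /predU1P[->|ni]; first by rewrite ltnn.
  by rewrite ni; exact: muA.
- move=> i j ij; rewrite ltnS leq_eqVlt => /predU1P[->|jn].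
    by rewrite ltnn /=; case: ifPn => [iN x Ax|_]; [apply: PC;
      exact: AP _ iN _ Ax|exact: subset_refl].
  by rewrite jn (leq_ltn_trans ij jn); exact: AS.
Qed.

End nonatomic.

(** * The weight and its primitive *)

Section weight.
Context {R : realType} (a : \bar R) (w : R -> R).
Local Notation mu := (@lebesgue_measure R).
Local Notation I := (itv0 a).
Local Notation b := (weight_total a w).
Local Notation J := (itv0 b).
Hypotheses (a0 : (0 < a)%E) (dw : decreasing_weight a w).

Definition weight_prim (t : R) : R := fine (weight_primitive w t).

Let mI : measurable I. Proof. exact: measurable_itv0. Qed.

Lemma weight_gt0 t : I t -> 0 < w t. Proof. by case: dw => + _ _; apply. Qed.

Lemma weight_ge0 t : I t -> 0 <= w t. Proof. by move=> /weight_gt0/ltW. Qed.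

Lemma weight_nonincreasing s t : I s -> I t -> s <= t -> w t <= w s.
Proof. by case: dw => _ + _; apply. Qed.

Lemma measurable_weight : measurable_fun I w.
Proof. exact: measurable_fun_nonincreasing_itv0 weight_nonincreasing. Qed.

Lemma itv0_half : exists t, I t.
Proof.
case: (a) a0 => [r| |] //; last by exists 1; split=> //; rewrite ltry.
by rewrite lte_fin => r0; exists (r / 2); split; [lra|rewrite lte_fin; lra].
Qed.

Lemma itv0_succ t : I t -> exists2 s, I s & t < s.
Proof.
move=> [t0 ta]; case: (a) ta => [r| |] //; last first.
  by exists (t + 1); [split; [lra|rewrite ltry]|lra].
by rewrite lte_fin => tr; exists ((t + r) / 2); [split; [lra|rewrite lte_fin; lra]|lra].
Qed.

Lemma weight_primE t : I t -> weight_primitive w t = (weight_prim t)%:E.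
Proof.
move=> It; rewrite fineK// ge0_fin_numE; first by case: dw => _ _; apply.
exact: (wmeasure_ge0 weight_ge0 (itv0S_mem It)).
Qed.

Let mwS A : measurable A -> A `<=` I -> measurable_fun A (fun x => (w x)%:E).
Proof.
by move=> mA AI; apply/measurable_EFinP; exact: measurable_funS measurable_weight.
Qed.

Lemma weight_prim_ge t : I t -> t * w t <= weight_prim t.
Proof.
move=> It; have [t0 _] := It; rewrite -lee_fin -weight_primE// EFinM muleC.
rewrite -(integral_itv0_cst (w t)%:E (ltW t0)); apply: ge0_le_integral => //.
- exact: measurable_itv0.
- by move=> s _; rewrite lee_fin weight_ge0.
- by apply: mwS; [exact: measurable_itv0|exact: itv0S_mem].
- move=> s ts; rewrite lee_fin weight_nonincreasing//; first exact: itv0S_mem ts.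
  by case: ts => _ /ltW.
Qed.

Lemma weight_prim_gt0 t : I t -> 0 < weight_prim t.
Proof.
move=> It; apply: lt_le_trans (weight_prim_ge It); rewrite mulr_gt0 ?weight_gt0//.
by case: It.
Qed.

(** The increment over [[s, t[] is at least [w t * (t - s)]. Strictness serves to place the values
    of the primitive inside the open interval [J]. *)
Lemma weight_prim_lt s t : I t -> 0 < s -> s < t -> weight_prim s < weight_prim t.
Proof.
move=> It s0 st; have Is : I s by exact: itv0_le It s0 (ltW st).
pose B := [set` `[s, t[] : set R.
have BI : B `<=` I.
  move=> u; rewrite /B/= in_itv/= => /andP[su ut]; apply: itv0_le It _ (ltW ut).
  exact: lt_le_trans su.
have mB : measurable B by exact: measurable_itv.
apply: (@lt_le_trans _ _ (weight_prim s + w t * (t - s))).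
  by rewrite ltrDl mulr_gt0 ?subr_gt0 ?weight_gt0.
rewrite -lee_fin EFinD -!weight_primE// /weight_primitive /wmeasure.
have tE : itv0 t%:E = itv0 s%:E `|` B.
  apply/seteqP; split => u; rewrite /B /itv0/= in_itv/= !lte_fin.
    by move=> [u0 ut]; have [us|su] := ltP u s; [left|right; rewrite ut].
  by move=> [[u0 us]|/andP[su ->]]; split=> //; [exact: lt_trans st|exact: lt_le_trans su].
rewrite tE ge0_integral_setU//; first last.
- apply/disj_setPS => u [[_ /=]]; rewrite lte_fin /B/= in_itv/= => us /andP[].
  by rewrite leNgt us.
- by move=> u; rewrite -tE => /(itv0S_mem It) Iu; rewrite lee_fin weight_ge0.
- by rewrite -tE; apply: mwS; [exact: measurable_itv0|exact: itv0S_mem].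
- exact: measurable_itv0.
apply: leeD2l; have muB : mu B = (t - s)%:E.
  by rewrite /B lebesgue_measure_itv/= lte_fin st EFinB.
apply: (@le_trans _ _ (\int[mu]_(u in B) cst (w t)%:E u)%E).
  by rewrite integral_cst// EFinM; rewrite le_eqVlt; apply/orP; left; apply/eqP; congr (_ * _)%E;
    exact/esym.
apply: ge0_le_integral => //.
- by move=> u _; rewrite lee_fin weight_ge0.
- exact: mwS.
- move=> u Bu; rewrite lee_fin weight_nonincreasing//; first exact: BI.
  by move: Bu; rewrite /B/= in_itv/= => /andP[_ /ltW].
Qed.

Lemma weight_prim_le s t : I t -> 0 < s -> s <= t -> weight_prim s <= weight_prim t.
Proof. by move=> It s0; rewrite le_eqVlt => /predU1P[->//|/(weight_prim_lt It s0)/ltW]. Qed.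

Lemma weight_prim_mem t : I t -> J (weight_prim t).
Proof.
move=> It; split; first exact: weight_prim_gt0.
have [s Is ts] := itv0_succ It; have t0 : 0 < t by case: It.
apply: (@lt_le_trans _ _ (weight_prim s)%:E); first by rewrite lte_fin weight_prim_lt.
rewrite -weight_primE//.
exact: (le_wmeasure mI measurable_weight weight_ge0 (measurable_itv0 _) mI
  (itv0S_mem Is) (@subset_refl _ _)).
Qed.

Lemma weight_total_gt0 : (0 < b)%E.
Proof.
have [t It] := itv0_half; have [W0 Wb] := weight_prim_mem It.
by apply: lt_trans Wb; rewrite lte_fin.
Qed.

End weight.

Lemma kothe_sup_ub (R : realType) (D : set R) (F : fun_space R) (f g : R -> R) :
  carrier F g -> gauge F g <= 1 ->
  (\int[@lebesgue_measure R]_(t in D) `|f t * g t|%:E <= kothe_sup D F f)%E.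
Proof. by move=> Fg g1; apply: ereal_sup_ubound; exists g. Qed.

Lemma kothe_sup_ge0 (R : realType) (D : set R) (F : fun_space R) (f g : R -> R) :
  carrier F g -> gauge F g <= 1 -> (0 <= kothe_sup D F f)%E.
Proof.
move=> Fg g1; apply: le_trans (kothe_sup_ub D f Fg g1).
by apply: integral_ge0 => t _; rewrite lee_fin.
Qed.

(** * Test functions in the unit ball of the Lorentz space *)

Section lorentz_test.
Context {R : realType} (a : \bar R) (w : R -> R) (E : fun_space R).
Local Notation mu := (@lebesgue_measure R).
Local Notation I := (itv0 a).
Local Notation b := (weight_total a w).
Local Notation J := (itv0 b).
Local Notation Lam := (Lambda_space a w (kothe_dual J E)).
Hypotheses (a0 : (0 < a)%E) (dw : decreasing_weight a w).
Hypotheses (bfsE : banach_function_space J E)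
  (fsE : fully_symmetric b E) (suppE : has_support J E).

Let mI : measurable I. Proof. exact: measurable_itv0. Qed.
Let mJ : measurable J. Proof. exact: measurable_itv0. Qed.
Let mw := measurable_weight dw.
Let w0 := weight_ge0 dw.
Let b0 : (0 < b)%E := weight_total_gt0 a0 dw.

Lemma measurable_sum_indic n (lam : nat -> R) (A : nat -> set R) (D : set R) :
  (forall i, (i < n)%N -> measurable (A i)) ->
  measurable_fun D (fun t => \sum_(i < n) lam i * \1_(A i) t).
Proof.
move=> mA; apply: measurable_sum => i; apply: measurable_funM; first exact: measurable_cst.
by apply: measurable_indic; exact: mA.
Qed.

(** Two step bounds in succession: the rearrangement of the function is at most the sum of the
    [lam i] on [(0, tau i)], and rearranging this for [w dm] replaces [tau i] by
    [weight_prim w (tau i)]. The resulting steps are in the unit ball of the dual of [E]. *)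
Lemma Lambda_steps n (A : nat -> set R) (tau lam : nat -> R) :
  (forall i, (i < n)%N -> measurable (A i) /\ A i `<=` I) ->
  (forall i j, (i <= j)%N -> (j < n)%N -> A i `<=` A j) ->
  (forall i, (i < n)%N -> I (tau i)) ->
  (forall i j, (i <= j)%N -> (j < n)%N -> tau i <= tau j) ->
  (forall i, (i < n)%N -> mu (A i) = (tau i)%:E) ->
  (forall i, (i < n)%N -> 0 <= lam i) ->
  (forall g, decreasing_in b E g ->
    \sum_(i < n) lam i * primitive g (weight_prim w (tau i)) <= gauge E g) ->
  carrier Lam (fun t => \sum_(i < n) lam i * \1_(A i) t) /\
  gauge Lam (fun t => \sum_(i < n) lam i * \1_(A i) t) <= 1.
Proof.
move=> mA AS Itau tauS muA lam0 lamE.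
set g := fun t => _.
have mg D : measurable_fun D g by apply: measurable_sum_indic => i /mA[].
have g0 t : 0 <= g t.
  by apply: sumr_ge0 => i _; rewrite mulr_ge0 ?lam0// indicE.
have gs t : I t -> (star I g t <= (\sum_(i < n) lam i * (t < tau i)%R%:R)%:E)%E.
  move=> [t0 _]; rewrite -[X in (_ <= X%:E)%E]add0r.
  apply: (star_le_steps mI (A := A)) => //; first by move=> i /muA ->.
  - exact: ltW.
  - by move=> y _; rewrite add0r ger0_norm.
have fing t : I t -> star I g t \is a fin_num.
  move=> It; rewrite ge0_fin_numE ?star_ge0//; exact: le_lt_trans (gs _ It) (ltry _).
pose G := fine \o star I g.
have mG D : measurable D -> measurable_fun D G.
  by move=> mD; apply: measurableT_comp => //; exact: measurable_star.
pose x i := weight_prim w (tau i).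
have Gs s : J s -> (wstar I w G s <= (\sum_(i < n) lam i * (s < x i)%R%:R)%:E)%E.
  move=> [s0 _]; rewrite -[X in (_ <= X%:E)%E]add0r.
  apply: (rearrangement_le_steps (A := fun i => itv0 (tau i)%:E)) => //.
  - exact: mG.
  - move=> i ni; split; first exact: measurable_itv0.
    by apply: itv0S_mem; exact: Itau.
  - by move=> i j ij jn; apply: itv0S; rewrite lee_fin tauS.
  - by move=> i ni; rewrite -(weight_primE dw (Itau _ ni)).
  - exact: ltW.
  - move=> t It; have t0 : 0 < t by case: It.
    rewrite add0r /G /= ger0_norm ?fine_ge0 ?star_ge0//.
    rewrite -lee_fin fineK ?fing//; apply: le_trans (gs _ It) _; rewrite lee_fin.
    apply: ler_sum => i _; rewrite ler_wpM2l ?lam0//; case: ltP => // tt.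
    by rewrite indicE mem_set.
have finG s : J s -> wstar I w G s \is a fin_num.
  move=> Js; rewrite ge0_fin_numE ?rearrangement_ge0//; exact: le_lt_trans (Gs _ Js) (ltry _).
have mH : measurable_fun J (fine \o wstar I w G).
  by apply: measurableT_comp => //; exact: measurable_wstar.
have k1 : (kothe_sup J E (fine \o wstar I w G) <= 1)%E.
  apply: (kothe_sup_steps b0 bfsE fsE suppE (x := fun i : 'I_n => x i)
    (lam := fun i : 'I_n => lam i)) => //.
  - by move=> i; apply: weight_prim_mem => //; exact: Itau.
  - by move=> i; exact: lam0.
  - move=> s Js /=; rewrite ger0_norm ?fine_ge0 ?rearrangement_ge0//.
    by rewrite -lee_fin fineK ?finG// Gs.
split.
  split; first exact: mg.
  split; first exact: ae_onT.
  split; first exact: mG.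
  split; first exact: ae_onT.
  by split=> //=; apply: le_lt_trans k1 _; rewrite ltry.
rewrite /= /egauge/= /egauge/=.
have k0 : (0 <= kothe_sup J E (fine \o wstar I w G))%E.
  by apply: (kothe_sup_ge0 _ _ (carrier0 bfsE)); rewrite (gauge0 bfsE).
rewrite -lee_fin fineK// ge0_fin_numE//; apply: le_lt_trans k1 _; exact: ltry.
Qed.

(** [A i] splits into the differences of consecutive sets; on the one of index [k], of measure
    [tau k - tau k.-1], [|f|] is at least [y k]. The first layer uses 0 as the preceding grid
    point. *)
Lemma integral_layers_ge (f : R -> R) n (A : nat -> set R) (tau y : nat -> R) :
  measurable_fun I f ->
  (forall i, (i < n)%N -> measurable (A i) /\ A i `<=` I) ->
  (forall i j, (i <= j)%N -> (j < n)%N -> A i `<=` A j) ->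
  (forall i, (i < n)%N -> mu (A i) = (tau i)%:E) ->
  (forall i, (i < n)%N -> 0 <= y i) ->
  (forall i, (i < n)%N -> forall t, A i t -> y i <= `|f t|) ->
  forall i, (i < n)%N ->
  ((\sum_(k < i.+1) y k * (tau k - (if k : nat is k'.+1 then tau k' else 0)))%:E <=
   \int[mu]_(t in A i) `|f t|%:E)%E.
Proof.
move=> mf mA AS muA y0 yf.
have mfA B : measurable B -> B `<=` I -> measurable_fun B (fun t => `|f t|%:E).
  move=> mB BI; apply/measurable_EFinP; apply: measurableT_comp => //.
  exact: measurable_funS mf.
have cstA B (c : R) (l : R) : measurable B -> B `<=` I -> mu B = l%:E -> 0 <= c ->
    (forall t, B t -> c <= `|f t|) -> ((c * l)%:E <= \int[mu]_(t in B) `|f t|%:E)%E.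
  move=> mB BI muB c0 cf; apply: (@le_trans _ _ (\int[mu]_(t in B) cst c%:E t)%E).
    rewrite integral_cst// EFinM le_eqVlt; apply/orP; left; apply/eqP.
    by congr (_ * _)%E; exact/esym.
  by apply: ge0_le_integral => //; exact: mfA.
elim=> [n0|i IH ni].
  rewrite big_ord1 subr0; apply: cstA; rewrite ?muA ?y0//;
    [exact: (mA _ n0).1|exact: (mA _ n0).2|exact: yf].
have ni' : (i < n)%N := ltnW ni.
have [mAi AiI] := mA _ ni'; have [mAS ASI] := mA _ ni.
pose B := A i.+1 `\` A i.
have mB : measurable B by exact: measurableD.
have AE : A i.+1 = A i `|` B by rewrite /B setDUK//; exact: AS.
have BI : B `<=` I by move=> t [/ASI].
have muB : mu B = (tau i.+1 - tau i)%:E.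
  have : mu (A i.+1) = (mu (A i) + mu B)%E.
    rewrite {1}AE measureU//; apply/seteqP; split => // t [? []//].
  rewrite !muA//; case: (mu B) => [r| |]//= [->]; congr EFin; lra.
rewrite big_ord_recr/= EFinD AE ge0_integral_setU//; first last.
- by apply/disj_setPS => t [? []].
- by rewrite -AE; exact: mfA.
apply: leeD; first exact: IH.
apply: cstA => //; first exact: y0.
by move=> t [At _]; exact: yf At.
Qed.

(* The test functions are \sum_i lam i * \1_(A i), where the nested sets A i of
   measure tau i are contained in {|f| >= y i}. *)
Lemma kothe_Lambda_test (f : R -> R) n (tau y lam : nat -> R) :
  carrier (kothe_dual I Lam) f ->
  (forall i, (i < n)%N -> I (tau i)) ->
  (forall i j, (i <= j)%N -> (j < n)%N -> tau i <= tau j) ->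
  (forall i, (i < n)%N -> 0 <= y i) ->
  (forall i j, (i <= j)%N -> (j < n)%N -> y j <= y i) ->
  (forall i, (i < n)%N -> ((tau i)%:E <= mu (I `&` [set t | (y i <= `|f t|)%R]))%E) ->
  (forall i, (i < n)%N -> 0 <= lam i) ->
  (forall g, decreasing_in b E g ->
    \sum_(i < n) lam i * primitive g (weight_prim w (tau i)) <= gauge E g) ->
  \sum_(i < n) lam i *
    \sum_(k < i.+1) y k * (tau k - (if k : nat is k'.+1 then tau k' else 0)) <=
  fine (kothe_sup I Lam f).
Proof.
move=> [mf Kfoo] Itau tauS y0 yS tauB lam0 lamE.
pose B i := I `&` [set t | (y i <= `|f t|)%R].
have mB i : measurable (B i) by exact: measurable_superlevel_ge.
have [A [mA AB muA AS]] : exists A : nat -> set R, [/\ forall i, (i < n)%N -> measurable (A i),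
    forall i, (i < n)%N -> A i `<=` B i,
    forall i, (i < n)%N -> mu (A i) = (tau i)%:E &
    forall i j, (i <= j)%N -> (j < n)%N -> A i `<=` A j].
  apply: lebesgue_nested_sets => //.
  - by move=> i _ t [[]].
  - by move=> i j ij jn t [It /= yt]; split=> //=; apply: le_trans yt; exact: yS.
  - by move=> i /Itau [/ltW].
have AI i : (i < n)%N -> measurable (A i) /\ A i `<=` I.
  by move=> ni; split; [exact: mA|move=> t /(AB _ ni) []].
have [Lg Lg1] := Lambda_steps AI AS Itau tauS muA lam0 lamE.
set g := fun t => _ in Lg Lg1.
have K0 := kothe_sup_ge0 I f Lg Lg1.
rewrite -lee_fin fineK ?ge0_fin_numE//.
apply: (@le_trans _ _ (\int[mu]_(t in I) `|f t * g t|%:E)%E); last first.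
  exact: kothe_sup_ub.
have mif i : (i < n)%N -> measurable_fun I (fun t => ((\1_(A i) t)%:E * `|f t|%:E)%E).
  move=> ni; apply: emeasurable_funM; apply/measurable_EFinP.
    by apply: measurable_indic; exact: mA.
  by apply: measurableT_comp.
have -> : (\int[mu]_(t in I) `|f t * g t|%:E = \int[mu]_(t in I)
    (\sum_(i < n) (lam i)%:E * ((\1_(A i) t)%:E * `|f t|%:E)))%E.
  apply: eq_integral => t _; under eq_bigr do rewrite -!EFinM mulrA.
  rewrite sumEFin -mulr_suml mulrC normrM; congr (_ * _)%:E.
  by rewrite ger0_norm// sumr_ge0// => i _; rewrite mulr_ge0 ?lam0// indicE.
rewrite ge0_integral_sum//; first last.
- by move=> i t _; rewrite !mule_ge0 ?lee_fin ?lam0.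
- by move=> i; apply: emeasurable_funM; [exact: measurable_cst|exact: mif].
rewrite -sumEFin; apply: lee_sum => i _.
rewrite ge0_integralZl_EFin//; [|exact: mif|exact: lam0].
rewrite EFinM; apply: lee_wpmul2l; first by rewrite lee_fin lam0.
rewrite integral_indic_mul; last exact: (AI _ (ltn_ord i)).2.
apply: (integral_layers_ge mf AI AS muA y0) => //.
by move=> k kn t /(AB _ kn) [].
Qed.

End lorentz_test.

(** The steps with [s < x i] are replaced by the constant [nu], their maximum, and the others are
    summed. At [s] that sum vanishes, which leaves the height of a single step; a bound by the sum
    of all heights would be too weak for the submajorization. *)
Lemma rearrangement_le_max (R : realType) (D : set R) (w : R -> R) (n : nat)
    (A : nat -> set R) (x c : nat -> R) (s : R) (g : R -> R) :
  measurable D -> measurable_fun D w -> (forall y, D y -> 0 <= w y) ->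
  measurable_fun D g ->
  (forall i, (i < n)%N -> measurable (A i) /\ A i `<=` D) ->
  (forall i j, (i <= j)%N -> (j < n)%N -> A i `<=` A j) ->
  (forall i, (i < n)%N -> (wmeasure w (A i) <= (x i)%:E)%E) ->
  (forall i, (i < n)%N -> 0 <= c i) -> 0 <= s ->
  (forall y, D y -> g y = 0 \/ exists i, [/\ (i < n)%N, A i y & `|g y| <= c i]) ->
  exists nu, (wstar D w g s <= nu%:E)%E /\
    (nu = 0 \/ exists i, [/\ (i < n)%N, s < x i & nu = c i]).
Proof.
move=> mD mw w0 mg mA AS wA c0 s0 gc.
pose nu := \big[Num.max/0]_(i < n | s < x i) c i.
pose lam i := if s < x i then 0 else c i.
exists nu; split.
  have : (wstar D w g s <= (nu + \sum_(i < n) lam i * (s < x i)%R%:R)%:E)%E.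
    apply: (rearrangement_le_steps (A := A)) => //.
    - rewrite /nu; elim/big_ind : _ => [//|u v u0 v0|i _]; [by rewrite le_max u0|exact: c0].
    - by move=> i ni; rewrite /lam; case: ifPn => // _; exact: c0.
    - move=> y Dy; have sum0 (P : pred 'I_n) : 0 <= \sum_(i < n | P i) lam i * \1_(A i) y.
        apply: sumr_ge0 => i _; rewrite indicE mulr_ge0// /lam.
        by case: ifPn => // _; exact: c0.
      have nu0 : 0 <= nu.
        rewrite /nu; elim/big_ind : _ => [//|u v u0 v0|i _]; [by rewrite le_max u0|exact: c0].
      case: (gc _ Dy) => [->|[i [ni Ay gi]]]; first by rewrite normr0 addr_ge0.
      apply: le_trans gi _; have [si|si] := boolP (s < x i).
        rewrite -[c i]addr0 lerD//.
        exact: (le_bigmax_cond _ (fun i : 'I_n => c i) (j := Ordinal ni)).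
      rewrite (bigD1 (Ordinal ni))//= /lam (negPf si) indicE mem_set// mulr1.
      by rewrite addrCA lerDl addr_ge0.
  rewrite big1 ?addr0// => i _; rewrite /lam; case: ifPn => _; rewrite ?mul0r//.
  by rewrite mulr0.
rewrite /nu; elim/big_ind : _ => [|u v hu hv|i si]; first by left.
  by rewrite /Num.max; case: ifP.
by right; exists i.
Qed.

(** * Submajorization from finitely many values of a primitive *)

Section step_estimate.
Context {R : realType} (b : \bar R) (E : fun_space R).
Local Notation mu := (@lebesgue_measure R).
Local Notation J := (itv0 b).
Hypotheses (b0 : (0 < b)%E) (bfsE : banach_function_space J E)
  (fsE : fully_symmetric b E) (suppE : has_support J E).

Let mJ : measurable J. Proof. exact: measurable_itv0. Qed.

(* Only the values of the primitive of g at the points x i are controlled. On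
   (0, y), the steps with x i <= y are summed up and the remaining ones are
   bounded by the largest of them, a single constant: both contributions are
   then at most the primitive of g at y, as this primitive is increasing and
   divided by y is decreasing. *)
Lemma submajorized_steps n (x z : nat -> R) (u g : R -> R) :
  (forall i, (i < n)%N -> J (x i)) ->
  (forall i j, (i <= j)%N -> (j < n)%N -> x i <= x j) ->
  (forall i, (i < n)%N -> 0 <= z i) -> decreasing_in b E g ->
  (forall i, (i < n)%N -> \sum_(k < i.+1) z k <= primitive g (x i)) ->
  measurable_fun J u ->
  (forall s, J s -> u s = 0 \/
    exists i, [/\ (i < n)%N, s < x i & `|u s| <= z i / x i]) ->
  carrier E u /\ gauge E u <= 2 * gauge E g.
Proof.
move=> Jx xS z0 dg zg mes_u uz.
have x0 i : (i < n)%N -> 0 < x i by move=> /Jx[].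
have Eg : carrier E g by case: dg.
have E2g := carrierZ bfsE 2 Eg.
have d2g : decreasing_in b E (fun t => 2 * g t) by exact: decreasing_inZ.
suff /(fsE.2 _ _ mes_u E2g)[Eu] : submajorized b u (fun t => 2 * g t).
  by rewrite (gaugeZ bfsE)// ger0_norm.
move=> y Jy; have [y0 _] := Jy.
have G0 := primitive_ge0 dg Jy.
pose nu := \big[Num.max/0]_(i < n | y < x i) (z i / x i).
pose lam i := if x i <= y then z i / x i else 0.
have zx0 i : (i < n)%N -> 0 <= z i / x i.
  by move=> ni; rewrite divr_ge0 ?z0// ltW// x0.
have lam0 i : (i < n)%N -> 0 <= lam i by move=> ni; rewrite /lam; case: ifPn => // _; exact: zx0.
have nu0 : 0 <= nu.
  rewrite /nu; elim/big_ind : _ => [//|p q p0 q0|i _]; [by rewrite le_max p0|exact: zx0].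
have su s : 0 <= s -> (star J u s <= (nu + \sum_(i < n) lam i * (s < x i)%R%:R)%:E)%E.
  move=> s0; apply: (star_le_steps mJ (A := fun i => itv0 (x i)%:E)) => //.
  - by move=> i ni; split; [exact: measurable_itv0|apply: itv0S_mem; exact: Jx].
  - by move=> i j ij jn; apply: itv0S; rewrite lee_fin xS.
  - by move=> i ni; rewrite lebesgue_measure_itv0// lee_fin ltW// x0.
  - move=> t Jt; have sum0 (P : pred 'I_n) :
        0 <= \sum_(i < n | P i) lam i * \1_(itv0 (x i)%:E) t.
      by apply: sumr_ge0 => i _; rewrite indicE mulr_ge0// lam0.
    case: (uz _ Jt) => [->|[i [ni tx ui]]]; first by rewrite normr0 addr_ge0.
    apply: le_trans ui _; have [xy|xy] := leP (x i) y.
      rewrite (bigD1 (Ordinal ni))//= /lam xy indicE mem_set; last by split=> //; case: Jt.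
      by rewrite mulr1 addrCA lerDl addr_ge0.
    rewrite -[z i / x i]addr0 lerD//.
    exact: (le_bigmax_cond _ (fun i : 'I_n => z i / x i) (j := Ordinal ni)).
have nuG : nu * y <= primitive g y.
  rewrite /nu; elim/big_ind : _ => [|p q hp hq|i yx]; first by rewrite mul0r.
    by rewrite /Num.max; case: ifP.
  have [ni xi0] := (ltn_ord i, x0 _ (ltn_ord i)).
  rewrite mulrAC ler_pdivrMr// [leRHS]mulrC;
    apply: le_trans (primitive_slope b0 bfsE fsE suppE dg (Jx _ ni) y0 (ltW yx)).
  rewrite mulrC; apply: ler_wpM2l; first exact: ltW.
  apply: le_trans (zg _ ni).
  by rewrite big_ord_recr/= lerDr sumr_ge0// => k _; exact: z0 (ltn_trans (ltn_ord k) ni).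
(* With [k] the last index such that [x k <= y], the sum is at most [z 0 + ... + z k]. *)
have lamG : \sum_(i < n) lam i * x i <= primitive g y.
  have [ex|nex] := pselect (exists i, (i < n)%N && (x i <= y)); last first.
    rewrite big1// => i _; rewrite /lam; case: ifPn => xy; rewrite ?mul0r//.
    by case: nex; exists i; rewrite ltn_ord.
  have bd i : (i < n)%N && (x i <= y) -> (i <= n)%N by move=> /andP[/ltnW].
  case: (ex_maxnP ex bd) => k /andP[kn xk] kmax.
  apply: le_trans (primitive_nondecreasing b0 bfsE fsE suppE dg Jy (x0 _ kn) xk).
  apply: le_trans (zg _ kn).
  rewrite -(big_mkord xpredT z) -(big_mkord xpredT (fun i => lam i * x i)).
  rewrite (big_cat_nat (n := k.+1))//= [X in _ + X]big1_seq ?addr0.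
    apply: ler_sum_nat => i /andP[_ ik]; rewrite /lam; case: ifPn => _.
      by rewrite divfK// gt_eqF// x0// (leq_ltn_trans _ kn).
    by rewrite mul0r z0// (leq_ltn_trans _ kn).
  move=> i; rewrite mem_index_iota => /andP[_ /andP[ki ni]].
  rewrite /lam; case: ifPn => xy; rewrite ?mul0r//.
  by have := kmax i; rewrite ni xy leqNgt ki => /(_ isT).
have mI1 i : measurable_fun (itv0 y%:E) (fun s => (lam i)%:E * (\1_(itv0 (x i)%:E) s)%:E)%E.
  apply: emeasurable_funM; first exact: measurable_cst.
  by apply/measurable_EFinP; apply: measurable_indic; exact: measurable_itv0.
have m_y := measurable_itv0 y%:E.
apply: (@le_trans _ _ (primitive (fun t => 2 * g t) y)%:E); last first.
  rewrite -(primitiveE b0 bfsE fsE suppE d2g Jy).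
  apply: le_trans (integral_abs_le_star (ltW b0) (carrier_measurable bfsE E2g) Jy).
  apply: ge0_le_integral => //.
  - by move=> t /(itv0S_mem Jy) Jt; rewrite lee_fin; case: d2g => _ + _; apply.
  - apply/measurable_EFinP; apply: measurable_funS (carrier_measurable bfsE E2g) => //.
    exact: itv0S_mem.
  - apply/measurable_EFinP; apply: measurableT_comp => //.
    apply: measurable_funS (carrier_measurable bfsE E2g) => //.
    exact: itv0S_mem.
  - by move=> t _; rewrite lee_fin ler_norm.
apply: (@le_trans _ _ (\int[mu]_(s in itv0 y%:E)
   (nu%:E + \sum_(i < n) (lam i)%:E * (\1_(itv0 (x i)%:E) s)%:E))%E).
  apply: ge0_le_integral => //.
  - by move=> s _; exact: star_ge0.
  - exact: measurable_star.
  - apply: emeasurable_funD; first exact: measurable_cst.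
    by apply: emeasurable_sum => i; exact: mI1.
  - move=> s [s0 sy]; apply: le_trans (su _ (ltW s0)) _.
    under [X in (_ <= _ + X)%E]eq_bigr do rewrite -EFinM.
    rewrite sumEFin -EFinD lee_fin lerD2l; apply: ler_sum => i _.
    by rewrite ler_wpM2l ?lam0//; case: ltP => // sx; rewrite indicE mem_set.
rewrite ge0_integralD//; first last.
- by apply: emeasurable_sum => i; exact: mI1.
- by move=> s _; apply: sume_ge0 => i _; rewrite mule_ge0 ?lee_fin ?lam0.
rewrite [X in (X + _ <= _)%E](_ : _ = (nu * y)%:E); last exact: integral_itv0_cst (ltW y0).
rewrite ge0_integral_sum//; [|by move=> i; exact: mI1|by move=> i s _;
  rewrite mule_ge0 ?lee_fin ?lam0].
rewrite (@primitiveZ _ _ _ b0 bfsE fsE suppE)// mulrDl !mul1r EFinD; apply: leeD;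
  first by rewrite lee_fin.
apply: (@le_trans _ _ (\sum_(i < n) lam i * x i)%:E); last by rewrite lee_fin.
rewrite -sumEFin; apply: lee_sum => i _.
rewrite ge0_integralZl_EFin//; last 2 first.
- by apply/measurable_EFinP; apply: measurable_indic; exact: measurable_itv0.
- exact: lam0.
rewrite EFinM; apply: lee_wpmul2l; first by rewrite lee_fin lam0.
have xi0 := x0 _ (ltn_ord i).
have muxi : mu (itv0 (x i)%:E) = (x i)%:E.
  by apply: lebesgue_measure_itv0; rewrite lee_fin ltW.
rewrite -[X in (_ <= X)%E]muxi.
rewrite integral_indic//; last exact: measurable_itv0.
apply: le_measure; rewrite ?inE; [|exact: measurable_itv0|by move=> t []].
by apply: measurableI; exact: measurable_itv0.
Qed.

End step_estimate.

(** * The norm estimate on a finite grid *)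

Section associate_norm.
Context {R : realType} (a : \bar R) (w : R -> R) (E : fun_space R) (C : R).
Local Notation mu := (@lebesgue_measure R).
Local Notation I := (itv0 a).
Local Notation b := (weight_total a w).
Local Notation J := (itv0 b).
Local Notation Lam := (Lambda_space a w (kothe_dual J E)).
Hypotheses (a0 : (0 < a)%E) (dw : decreasing_weight a w).
Hypotheses (bfsE : banach_function_space J E)
  (fsE : fully_symmetric b E) (suppE : has_support J E).

Let mI : measurable I. Proof. exact: measurable_itv0. Qed.
Let mJ : measurable J. Proof. exact: measurable_itv0. Qed.
Let mw := measurable_weight dw.
Let w0 := weight_ge0 dw.
Let b0 : (0 < b)%E := weight_total_gt0 a0 dw.

(** If the rearrangement were infinite at [t], [|f|] would exceed every level [y] on a set of
    measure greater than [t]. One layer of height [lam > 0] as test function would bound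
    [lam * y * t] for all [y]. *)
Lemma kothe_Lambda_star_lty f t : carrier (kothe_dual I Lam) f -> I t ->
  (star I f t < +oo)%E.
Proof.
move=> Kf It; have [mf _] := Kf; have [t0 _] := It.
pose x := weight_prim w t; have Jx : J x by exact: weight_prim_mem.
have x0 : 0 < x by case: Jx.
have G0 := gauge_indic_gt0 bfsE suppE Jx.
(* A decreasing [g] whose primitive at [x] is at least [x] submajorizes the indicator of [(0, x)] up
   to a factor 2. So half the gauge of the indicator is admissible as [rho], and being positive it
   forces [lam ord0 > 0]. *)
have [g dg|lam [lam0 lamx lamE]] := @dual_weights _ _ _ b0 bfsE fsE suppE 1 (fun=> x)
    (fun=> x) (gauge E (\1_(itv0 x%:E)) / 2) (fun=> Jx).
  move=> /(_ ord0) xg; rewrite ler_pdivrMr// mulrC.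
  apply: (submajorized_steps b0 bfsE fsE suppE (n := 1) (x := fun=> x) (z := fun=> x)
    _ _ _ dg _ _ _).2 => //.
  - by move=> i _; exact: ltW.
  - by move=> [|//] _; rewrite big_ord1.
  - by apply: measurable_indic; exact: measurable_itv0.
  - move=> s [s0 _]; have [sx|xs] := ltP s x.
      right; exists 0%N; split => //.
      by rewrite divff ?gt_eqF// ger0_norm indicE//; case: (_ \in _).
    by left; rewrite indicE memNset// => -[_]; rewrite lte_fin ltNge xs.
have lam_gt0 : 0 < lam ord0.
  move: lamx; rewrite big_ord1 => lamx.
  have := lt_le_trans (divr_gt0 G0 (ltr0Sn _ 1)) lamx.
  by rewrite pmulr_lgt0.
pose K := fine (kothe_sup I Lam f).
rewrite ltNge leye_eq; apply/negP => /eqP too.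
(* Chosen so that [lam ord0 * (y * t)] is [|K| + lam ord0 * t], which exceeds [K]. *)
pose y := `|K| / (lam ord0 * t) + 1.
have y0 : 0 <= y by rewrite addr_ge0// divr_ge0// mulr_ge0// ltW.
have := @kothe_Lambda_test _ _ _ _ a0 dw bfsE fsE suppE f 1 (fun=> t) (fun=> y)
  (fun=> lam ord0) Kf.
rewrite !big_ord1 subr0 -/K => H.
have : lam ord0 * (y * t) <= K.
  apply: H => //.
  - have : (t%:E < distribution_fun mu I f y)%E by rewrite -star_gtP// too ltry.
    move=> /ltW/le_trans dle i _; apply: dle.
    apply: le_measure; rewrite ?inE.
    + exact: measurable_superlevel.
    + exact: measurable_superlevel_ge.
    + by move=> u [Iu /= /ltW yu]; split.
  - by move=> g dg; have := lamE g dg; rewrite !big_ord1.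
rewrite mulrCA [lam _ * t]mulrC mulrA -mulrA [t * _]mulrC; apply/negP; rewrite -ltNge.
apply: le_lt_trans (ler_norm K) _.
rewrite /y mulrDl divfK ?gt_eqF ?mulr_gt0// mul1r ltrDl mulr_gt0//.
Qed.

Hypothesis (C1 : 1 <= C)
  (wC : forall t, I t -> (weight_primitive w t <= (C * t * w t)%:E)%E).

Lemma weight_prim_le_regular t : I t -> (w t)^-1 <= C * t / weight_prim w t.
Proof.
move=> It; have w1 := weight_gt0 dw It; have W1 := weight_prim_gt0 dw It.
rewrite ler_pdivlMr// mulrC ler_pdivrMr//.
by rewrite -lee_fin -(weight_primE dw It) wC.
Qed.

(** [phi] stands for a truncation of the quotient of [star I f] by [w]; only the bound and the
    support enter. *)
Lemma kothe_Lambda_truncation_le f (phi : R -> R) (alpha : R) (N : nat) :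
  carrier (kothe_dual I Lam) f -> 0 < alpha -> I (alpha * 2 ^+ N) ->
  measurable_fun I phi ->
  (forall t, I t -> `|phi t| <= fine (star I f t) / w t) ->
  (forall t, I t -> phi t != 0 -> alpha <= t < alpha * 2 ^+ N) ->
  [/\ forall s, J s -> wstar I w phi s \is a fin_num,
    carrier E (fine \o wstar I w phi) &
    gauge E (fine \o wstar I w phi) <= 16 * C * fine (kothe_sup I Lam f)].
Proof.
move=> Kf al0 IN mphi phile phi0.
have [mf _] := Kf.
pose tau i := alpha * 2 ^+ i.
have tau0 i : 0 < tau i by rewrite mulr_gt0// exprn_gt0.
have tauS i j : (i <= j)%N -> tau i <= tau j.
  by move=> ij; rewrite ler_pM2l// ler_weXn2l// ler1n.
have Itau i : (i < N.+1)%N -> I (tau i).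
  by move=> iN; apply: itv0_le IN _ _ => //; exact: tauS.
pose x i := weight_prim w (tau i).
have Jx i : (i < N.+1)%N -> J (x i) by move=> iN; apply: weight_prim_mem => //; exact: Itau.
have x0 i : (i < N.+1)%N -> 0 < x i by move=> /Jx[].
have xS i j : (i <= j)%N -> (j < N.+1)%N -> x i <= x j.
  by move=> ij jN; apply: (weight_prim_le dw) => //; [exact: Itau|exact: tauS].
(* Unless [y i = 0], when the set where [|f|] is at least [y i] is all of [I], halving puts [y i]
   strictly below the rearrangement at [tau i], so that this set has measure at least [tau i]. *)
pose y i := fine (star I f (tau i)) / 2.
have sfin t : I t -> star I f t \is a fin_num.
  by move=> It; rewrite ge0_fin_numE ?star_ge0// kothe_Lambda_star_lty.
have y0 i : 0 <= y i by rewrite divr_ge0// fine_ge0// star_ge0.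
have yS i j : (i <= j)%N -> (j < N.+1)%N -> y j <= y i.
  move=> ij jN; rewrite ler_pM2r ?invr_gt0// fine_le ?sfin//; [exact: Itau| |].
  - by apply: Itau; exact: leq_ltn_trans jN.
  - by apply: star_nonincreasing; exact: tauS.
(* The constant absorbs the halving in [y i], the ratio [tau i.+1 = 2 * tau i] and regularity. *)
pose z i := 4 * C * (y i * tau i).
have C0 : 0 < C by exact: lt_le_trans C1.
have z0 i : 0 <= z i by apply: mulr_ge0; apply: mulr_ge0 => //; exact: ltW.
(* On [[tau i, tau i.+1[] the increasing function [1/w] is bounded by its value at the right end,
   hence the index [i.+1]. *)
pose c i := z i / x i.+1.
have c0 i : (i < N)%N -> 0 <= c i by move=> iN; rewrite divr_ge0// ltW// x0.
have phic t : I t -> phi t = 0 \/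
    exists i, [/\ (i < N)%N, itv0 (tau i.+1)%:E t & `|phi t| <= c i].
  move=> It; have [->|ph] := eqVneq (phi t) 0; [by left|right].
  have /andP[alt tN] := phi0 _ It ph.
  have ex : exists i, t < tau i by exists N.
  case: (ex_minnP ex) => m tm mmin.
  case: m tm mmin => [|m] tm mmin.
    by move: tm; rewrite /tau expr0 mulr1 ltNge alt.
  have mN : (m < N)%N by exact: mmin.
  have mt : tau m <= t by rewrite leNgt; apply/negP => /mmin; rewrite ltnn.
  have ItS : I (tau m.+1) by exact: Itau.
  exists m; split => //; first by split; [case: It|].
  apply: le_trans (phile _ It) _.
  have Itm : I (tau m) by apply: Itau; exact: ltnW.
  have s1 : fine (star I f t) <= 2 * y m.
    rewrite /y mulrCA divff ?mulr1 ?pnatr_eq0// fine_le ?sfin//.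
    exact: star_nonincreasing.
  have w1 : (w t)^-1 <= C * tau m.+1 / x m.+1.
    apply: le_trans (weight_prim_le_regular ItS).
    rewrite lef_pV2 ?posrE ?(weight_gt0 dw)//.
    by apply: (weight_nonincreasing dw) => //; exact: ltW.
  apply: (@le_trans _ _ ((2 * y m) * (C * tau m.+1 / x m.+1))).
    by apply: ler_pM => //; [rewrite fine_ge0// star_ge0|rewrite invr_ge0 w0].
  rewrite le_eqVlt; apply/orP; left; apply/eqP.
  by rewrite /c /z /tau exprS; ring.
pose u := fine \o wstar I w phi.
have mes_u : measurable_fun J u by apply: measurableT_comp => //; exact: measurable_wstar.
have nuP s : J s -> exists nu, (wstar I w phi s <= nu%:E)%E /\
    (nu = 0 \/ exists i, [/\ (i < N)%N, s < x i.+1 & nu = c i]).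
  move=> [s0 _]; apply: (@rearrangement_le_max _ I w N
    (fun i => itv0 (tau i.+1)%:E) (fun i => x i.+1) c s phi mI mw w0 mphi _ _ _ c0 (ltW s0) phic).
  - by move=> i iN; split; [exact: measurable_itv0|apply: itv0S_mem; exact: Itau].
  - by move=> i j ij _; apply: itv0S; rewrite lee_fin tauS.
  - by move=> i iN; rewrite -(weight_primE dw (Itau _ _)).
have su s : J s -> wstar I w phi s \is a fin_num.
  move=> /nuP[nu [unu _]].
  by rewrite ge0_fin_numE ?rearrangement_ge0//; exact: le_lt_trans unu (ltry _).
have uz s : J s -> u s = 0 \/ exists i, [/\ (i < N)%N, s < x i.+1 & `|u s| <= z i / x i.+1].
  move=> Js; have [nu [unu nuc]] := nuP _ Js.
  have u0 : 0 <= u s by rewrite /u/= fine_ge0// rearrangement_ge0.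
  have unu' : u s <= nu by rewrite -lee_fin /u/= fineK ?su.
  case: nuc => [nu0|[i [iN sx nuE]]].
    by left; apply/eqP; rewrite eq_le u0 andbT -nu0.
  by right; exists i; split => //; rewrite ger0_norm// -/(c i) -nuE.
(* [u] is bounded and vanishes from [x N] on, so a multiple of an indicator dominates it. *)
have Eu : carrier E u.
  pose M := \sum_(i < N) z i / x i.+1.
  have JN := Jx _ (ltnSn N).
  apply: (carrier_solid bfsE mes_u (carrierZ bfsE M (carrier_indic suppE JN))).
  apply: ae_onT => s Js.
  have M0 (P : pred 'I_N) : 0 <= \sum_(i < N | P i) z i / x i.+1.
    by apply: sumr_ge0 => i _; exact: c0.
  case: (uz _ Js) => [->|[i [iN sx ui]]]; first by rewrite normr0.
  apply: le_trans ui _; rewrite indicE mem_set; last first.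
    by split; [case: Js|rewrite lte_fin; apply: lt_le_trans sx _; exact: xS].
  rewrite mulr1 ger0_norm; last exact: M0.
  by rewrite /M (bigD1 (Ordinal iN))//= lerDl M0.
split => //.
(* The conditions are imposed at [x i] although the steps of [u] end at [x i.+1]: the test uses sets
   of measure [tau i], on which [|f|] is at least [y i]. As primitives are nondecreasing, the
   conditions persist at [x i.+1]. *)
have [i|g dg|lam [lam0 lamz lamE]] := @dual_weights _ _ _ b0 bfsE fsE suppE N
    (fun i : 'I_N => x i) (fun i : 'I_N => \sum_(k < i.+1) z k) (gauge E u / 2) _.
- by apply: Jx; exact: ltnW (ltn_ord i).
- move=> zg; rewrite ler_pdivrMr// mulrC.
  apply: (submajorized_steps b0 bfsE fsE suppE (n := N) (x := fun i => x i.+1) (z := z)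
    _ _ _ dg _ mes_u uz).2 => //.
  + by move=> i iN; exact: Jx.
  + by move=> i j ij jN; exact: xS.
  + move=> i iN; apply: le_trans (zg (Ordinal iN)) _.
    apply: (primitive_nondecreasing b0 bfsE fsE suppE dg); [exact: Jx|exact: x0 (ltnW _)|].
    exact: xS.
pose lam' i := oapp lam 0 (insub i).
have lamP (i : 'I_N) : lam' i = lam i by rewrite /lam' valK.
have T := @kothe_Lambda_test _ _ _ _ a0 dw bfsE fsE suppE f N tau y lam' Kf.
have {}T : \sum_(i < N) lam' i *
    \sum_(k < i.+1) y k * (tau k - (if k : nat is k'.+1 then tau k' else 0)) <=
    fine (kothe_sup I Lam f).
  apply: T => //.
  - by move=> i iN; apply: Itau; exact: ltnW.
  - by move=> i j ij _; exact: tauS.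
  - by move=> i j ij jN; apply: yS => //; exact: ltnW.
  - move=> i iN; have Ii : I (tau i) by apply: Itau; exact: ltnW.
    have [yi0|yi0] := eqVneq (y i) 0.
      rewrite (_ : [set t | _] = setT) ?setIT.
        by rewrite lebesgue_measure_itv0 ?(ltW a0)//; case: Ii => _ /ltW.
      by apply/seteqP; split => // t _ /=; rewrite yi0.
    have : ((tau i)%:E < distribution_fun mu I f (y i))%E.
      rewrite -star_gtP// -(fineK (sfin _ Ii)) lte_fin.
      have : 0 < y i by rewrite lt_neqAle eq_sym yi0 y0.
      rewrite /y; lra.
    move=> /ltW/le_trans; apply; apply: le_measure; rewrite ?inE.
    + exact: measurable_superlevel.
    + exact: measurable_superlevel_ge.
    + by move=> t [It /= /ltW yt]; split.
  - by move=> i iN; rewrite (lamP (Ordinal iN)).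
  - move=> g dg; under eq_bigr do rewrite lamP; exact: lamE.
have : gauge E u / 2 <= 8 * C * fine (kothe_sup I Lam f).
  apply: le_trans lamz _.
  apply: le_trans (_ : _ <= 8 * C * _) _; last first.
    by apply: ler_wpM2l T; rewrite mulr_ge0// ltW.
  rewrite mulr_sumr; apply: ler_sum => i _; rewrite lamP mulrCA ler_wpM2l//.
  rewrite mulr_sumr; apply: ler_sum => k _.
  (* The layer width is [tau k / 2] for [k > 0] and [tau 0] for [k = 0], so passing to widths costs
     a factor 2. *)
  rewrite /z; have -> : 4 * C * (y k * tau k) = 8 * C * (y k * (tau k / 2)) by lra.
  apply: ler_wpM2l; first by apply: mulr_ge0 => //; exact: ltW.
  apply: ler_wpM2l; first exact: y0.
  case: (nat_of_ord k) => [|k']; first by have := tau0 0%N; lra.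
  by rewrite /tau exprS; have := tau0 k'; rewrite /tau; lra.
rewrite ler_pdivrMr//; lra.
Qed.

End associate_norm.

(** * Exhaustion of the interval and limits of rearrangements *)

Section truncation.
Context {R : realType} (a : \bar R).
Local Notation I := (itv0 a).

Lemma itv0_exhaustion : (0 < a)%E -> exists beta : nat -> R,
  [/\ forall n, I (beta n), {homo beta : m n / (m <= n)%N >-> m <= n} &
      forall t, I t -> exists n, t < beta n].
Proof.
case: a => [r| |] //; last first.
  move=> _; exists (fun n => n.+1%:R); split.
  - by move=> n; split; [rewrite ltr0n|rewrite ltry].
  - by move=> m n mn; rewrite ler_nat ltnS.
  - move=> t [/ltW t0 _]; exists (Num.bound t); apply: lt_trans (archi_boundP t0) _.
    by rewrite ltr_nat.
(* The shift to [n.+2] makes the first point positive. *)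
rewrite lte_fin => r0; exists (fun n => r * (1 - n.+2%:R^-1)); split.
- move=> n; have n2 : (0 : R) < n.+2%:R^-1 by rewrite invr_gt0 ltr0n.
  have n1 : n.+2%:R^-1 < (1 : R) by rewrite invf_lt1 ?ltr0n// ltr1n.
  split; first by rewrite mulr_gt0// subr_gt0.
  by rewrite lte_fin -[ltRHS]mulr1 ltr_pM2l//; lra.
- move=> m n mn; rewrite ler_pM2l// lerD2l lerN2 lef_pV2 ?posrE ?ltr0n// ler_nat.
  by rewrite !ltnS.
- move=> t [t0]; rewrite lte_fin => tr.
  have d0 : 0 <= r / (r - t) by rewrite divr_ge0 ?subr_ge0 ?ltW.
  exists (Num.bound (r / (r - t))).
  set n := Num.bound _; have := archi_boundP d0; rewrite -/n ltr_pdivrMr ?subr_gt0// => rn.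
  have n2 : (0 : R) < n.+2%:R by rewrite ltr0n.
  have : r / n.+2%:R < r - t.
    rewrite ltr_pdivrMr// mulrC; apply: lt_le_trans rn _.
    by rewrite ler_pM2r ?subr_gt0// ler_nat ltnW.
  by rewrite mulrBr mulr1 ltrBrDl -ltrBrDr.
Qed.

End truncation.

(** The superlevel set of [phi] at [r] is the increasing union of those of the [phi_ n], so
    continuity from below applies. *)
Lemma wstar_sup (R : realType) (D : set R) (w : R -> R) (phi : R -> R)
    (phi_ : nat -> R -> R) (s r : R) :
  measurable D -> measurable_fun D w -> (forall y, D y -> 0 <= w y) ->
  measurable_fun D phi -> (forall n, measurable_fun D (phi_ n)) ->
  (forall n t, D t -> `|phi_ n t| <= `|phi_ n.+1 t|) ->
  (forall n t, D t -> `|phi_ n t| <= `|phi t|) ->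
  (forall t, D t -> exists n, phi_ n t = phi t) -> 0 <= r ->
  (forall n, (wstar D w (phi_ n) s <= r%:E)%E) -> (wstar D w phi s <= r%:E)%E.
Proof.
move=> mD mw w0 mphi mphi_ inc le eqn r0 bnd; rewrite leNgt; apply/negP.
rewrite (rearrangement_gtP mD mw w0)//.
have inc2 t : D t -> {homo (fun n => `|phi_ n t|) : m n / (m <= n)%N >-> m <= n}.
  by move=> Dt; apply: homo_leq => //; [exact: le_trans|move=> n; exact: inc].
have DE : D `&` [set t | r < `|phi t|] = \bigcup_n (D `&` [set t | r < `|phi_ n t|]).
  apply/seteqP; split => [t [Dt /= rt]|t [n _ [Dt /= rt]]]; last first.
    by split => //=; exact: (lt_le_trans rt (le _ _ Dt)).
  by have [n En] := eqn _ Dt; exists n => //; split=> //=; rewrite En.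
rewrite /distribution_fun DE => /(wmeasure_lt_bigcup mD mw w0)[|||n].
- by move=> n; exact: measurable_superlevel.
- by move=> n t [].
- by move=> m n mn t [Dt /= rt]; split=> //=; apply: lt_le_trans rt _; exact: inc2.
rewrite -[wmeasure _ _]/(distribution_fun (wmeasure w) D (phi_ n) r).
by rewrite -(rearrangement_gtP mD mw w0)// ltNge bnd.
Qed.

(** * The two inclusions *)

Section associate_space.
Context {R : realType} (a : \bar R) (w : R -> R) (E : fun_space R).
Local Notation mu := (@lebesgue_measure R).
Local Notation I := (itv0 a).
Local Notation b := (weight_total a w).
Local Notation J := (itv0 b).
Local Notation Lam := (Lambda_space a w (kothe_dual J E)).
Hypotheses (a0 : (0 < a)%E) (dw : decreasing_weight a w).
Hypotheses (bfsE : banach_function_space J E)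
  (fsE : fully_symmetric b E) (suppE : has_support J E).

Let mI : measurable I. Proof. exact: measurable_itv0. Qed.
Let mJ : measurable J. Proof. exact: measurable_itv0. Qed.
Let mw := measurable_weight dw.
Let w0 := weight_ge0 dw.
Let b0 : (0 < b)%E := weight_total_gt0 a0 dw.

Lemma measurable_star_over_weight f :
  measurable_fun I (fine \o star_over_weight a w f).
Proof.
apply: measurableT_comp => //; apply: emeasurable_funM; first exact: measurable_star.
apply/measurable_EFinP; rewrite (_ : (fun t => (w t)^-1) = (fun t => - (- (w t)^-1))).
  apply: measurableT_comp => //.
  apply: measurable_fun_nonincreasing_itv0 => s t Is It st.
  by rewrite lerN2 lef_pV2 ?posrE ?(weight_gt0 dw)// (weight_nonincreasing dw).
by apply/funext => t; rewrite opprK.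
Qed.

Lemma kothe_Lambda_sub_M (C : R) f : 1 <= C ->
  (forall t, I t -> (weight_primitive w t <= (C * t * w t)%:E)%E) ->
  fatou_property J E -> carrier (kothe_dual I Lam) f ->
  carrier (M_space a w E) f /\
  gauge (M_space a w E) f <= 16 * C * gauge (kothe_dual I Lam) f.
Proof.
move=> C1 wC fatouE Kf; have [mf _] := Kf.
set K := gauge (kothe_dual I Lam) f.
pose phi := fine \o star_over_weight a w f.
have mphi : measurable_fun I phi by exact: measurable_star_over_weight.
have sfin t : I t -> star I f t \is a fin_num.
  move=> It; rewrite ge0_fin_numE ?star_ge0//.
  exact: (kothe_Lambda_star_lty a0 dw bfsE fsE suppE Kf).
have swfin t : I t -> star_over_weight a w f t \is a fin_num.
  by move=> It; rewrite /star_over_weight fin_numM// sfin.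
have phiE t : I t -> phi t = fine (star I f t) / w t.
  by move=> It; rewrite /phi/= /star_over_weight fineM// sfin.
have [beta [Ibeta betaS beta_ex]] := itv0_exhaustion a0.
pose S n : set R := `[n.+1%:R^-1, beta n[%classic.
pose phi_ n t := phi t * \1_(S n) t.
have mphi_ n : measurable_fun I (phi_ n).
  by apply: measurable_funM => //; apply: measurable_indic; exact: measurable_itv.
have phi_inc n t : I t -> `|phi_ n t| <= `|phi_ n.+1 t|.
  move=> _; rewrite /phi_ !normrM ler_wpM2l// !indicE.
  case: (boolP (t \in S n)) => [|_]; last by rewrite normr0.
  rewrite inE /S/= in_itv/= => /andP[nt tb]; rewrite mem_set// /S/= in_itv/=.
  rewrite (lt_le_trans tb) ?betaS// andbT; apply: le_trans nt.
  by rewrite lef_pV2 ?posrE// ler_nat.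
have phi_le n t : I t -> `|phi_ n t| <= `|phi t|.
  move=> _; rewrite /phi_ normrM ler_piMr// indicE.
  by case: (_ \in _); rewrite ?normr1 ?normr0.
have phi_eq t : I t -> exists n, phi_ n t = phi t.
  move=> It; have [t0 _] := It; have [n tn] := beta_ex _ It.
  have [m mt] : exists m, m.+1%:R^-1 < t.
    by have [m] := ltr_add_invr t0; rewrite add0r => mt; exists m.
  exists (maxn m n); rewrite /phi_ indicE mem_set ?mulr1// /S/= in_itv/=.
  rewrite (lt_le_trans tn) ?betaS ?leq_maxr// andbT.
  apply: le_trans (ltW mt); rewrite lef_pV2 ?posrE// ler_nat ltnS.
  exact: leq_maxl.
pose u n := fine \o wstar I w (phi_ n).
have uP n : [/\ forall s, J s -> wstar I w (phi_ n) s \is a fin_num,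
    carrier E (u n) & gauge E (u n) <= 16 * C * K].
  have bn0 : 0 < beta n by case: (Ibeta n).
  (* The grid must end exactly at [beta n] and begin below [1/(n+1)], hence
     [alpha = beta n / 2 ^+ N] with [2 ^+ N > beta n * (n+1)]. *)
  pose N := Num.bound (beta n * n.+1%:R).
  have : beta n * n.+1%:R < 2 ^+ N by apply: upper_nthrootP.
  rewrite -ltr_pdivlMr// => bN.
  have p2 : (0 : R) < 2 ^+ N by rewrite exprn_gt0.
  apply: (kothe_Lambda_truncation_le a0 dw bfsE fsE suppE C1 wC
    (alpha := beta n / 2 ^+ N) (N := N) Kf) => //.
  - exact: divr_gt0.
  - by rewrite divfK ?gt_eqF.
  - move=> t It; apply: le_trans (phi_le n t It) _.
    by rewrite phiE// ger0_norm// divr_ge0 ?w0// fine_ge0// star_ge0.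
  - move=> t It; rewrite /phi_ indicE; case: (boolP (t \in S n)); last by rewrite mulr0 eqxx.
    rewrite inE /S/= in_itv/= => /andP[nt tb] _; rewrite divfK ?gt_eqF// tb andbT.
    apply: le_trans nt; rewrite ler_pdivrMr// mulrC ler_pdivlMr// ltW//.
    by rewrite -ltr_pdivlMr.
have unfin n s : J s -> wstar I w (phi_ n) s \is a fin_num by case: (uP n) => + _ _; apply.
have Eu n : carrier E (u n) by case: (uP n).
have uB n : gauge E (u n) <= 16 * C * K by case: (uP n).
have u0 n s : 0 <= u n s by rewrite /u/= fine_ge0// rearrangement_ge0.
have uE n s : J s -> wstar I w (phi_ n) s = (u n s)%:E by move=> Js; rewrite fineK ?unfin.
(* [u n] is nonincreasing, so [u n s] times the indicator of [(0, s)] lies below it, and the uniform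
   bound on the gauges bounds [u n s]. This makes the limit finite, as the Fatou property requires a
   real-valued one. *)
have bound s : J s -> exists2 r, 0 <= r & forall n, (wstar I w (phi_ n) s <= r%:E)%E.
  move=> Js; have G0 := gauge_indic_gt0 bfsE suppE Js.
  have Es := carrier_indic suppE Js.
  have le n : u n s * gauge E (\1_(itv0 s%:E) : R -> R) <= 16 * C * K.
    apply: le_trans (uB n); rewrite -[u n s in leLHS](ger0_norm (u0 n s)) -(gaugeZ bfsE)//.
    apply: (gauge_le bfsE) => //; first exact: carrierZ bfsE _ _ Es.
    apply: ae_onT => t Jt; rewrite indicE; case: (boolP (t \in _)); last by rewrite mulr0 normr0.
    rewrite inE mulr1 => -[_]; rewrite lte_fin => /ltW ts.
    rewrite !ger0_norm// -lee_fin -(uE n _ Js) -(uE n _ Jt); exact: rearrangement_nonincreasing.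
  exists (16 * C * K / gauge E (\1_(itv0 s%:E) : R -> R)).
    by apply: le_trans (u0 0%N s) _; rewrite ler_pdivlMr.
  by move=> n; rewrite uE// lee_fin ler_pdivlMr.
have sup s r : 0 <= r -> (forall n, (wstar I w (phi_ n) s <= r%:E)%E) ->
    (wstar I w phi s <= r%:E)%E.
  exact: (wstar_sup mI mw w0 mphi mphi_ phi_inc phi_le phi_eq).
have wfin s : J s -> wstar I w phi s \is a fin_num.
  move=> /bound[r r0 /(sup _ _ r0) wr].
  by rewrite ge0_fin_numE ?rearrangement_ge0//; exact: le_lt_trans wr (ltry _).
pose v := fine \o wstar I w phi.
have vE s : J s -> wstar I w phi s = (v s)%:E by move=> Js; rewrite fineK ?wfin.
have uS s n : J s -> u n s <= u n.+1 s.
  by move=> Js; exact: (fine_le (unfin n _ Js) (unfin n.+1 _ Js)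
    (le_rearrangement mI mw w0 _ (mphi_ n) (mphi_ n.+1) (phi_inc n))).
have uv s n : J s -> u n s <= v s.
  by move=> Js; exact: (fine_le (unfin n _ Js) (wfin _ Js)
    (le_rearrangement mI mw w0 _ (mphi_ n) mphi (phi_le n))).
have ucvg s : J s -> (fun n => u n s) @ \oo --> v s.
  move=> Js; have nd : nondecreasing_seq (fun n => u n s).
    by apply/nondecreasing_seqP => n; exact: uS.
  have cv : cvgn (fun n => u n s).
    by apply: nondecreasing_is_cvgn => //; exists (v s) => _ [n _ <-]; exact: uv.
  have ul n : u n s <= limn (fun n => u n s) by exact: nondecreasing_cvgn_le.
  suff -> : v s = limn (fun n => u n s) by exact: cv.
  apply/eqP; rewrite eq_le; apply/andP; split; last first.
    by apply: limr_le => //; apply: nearW => n; exact: uv.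
  rewrite -lee_fin -vE//; apply: sup; first exact: le_trans (u0 0%N s) (ul 0%N).
  by move=> n; rewrite uE// lee_fin.
have mv : measurable_fun J v by apply: measurableT_comp => //; exact: measurable_wstar.
have [Ev _ gcvg] : [/\ carrier E v, forall n, gauge E (u n) <= gauge E (u n.+1) &
    (fun n => gauge E (u n)) @ \oo --> gauge E v].
  apply: fatouE => //.
  - by apply: ae_onT => s Js n; rewrite u0 uS.
  - exact: ae_onT.
  - by exists (16 * C * K).
split.
  split; first exact: mf.
  split; first exact: ae_onT.
  split; first exact: mphi.
  by split; first exact: ae_onT.
rewrite -[leLHS]/(gauge E v) -(cvg_lim _ gcvg)//.
apply: limr_le; first by apply/cvg_ex; eexists; exact: gcvg.
by apply: nearW.
Qed.

Lemma M_sub_kothe_Lambda f : carrier (M_space a w E) f ->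
  carrier (kothe_dual I Lam) f /\
  gauge (kothe_dual I Lam) f <= gauge (M_space a w E) f.
Proof.
move=> [mf [swfin [mphi [wfin EU]]]].
pose phi := fine \o star_over_weight a w f.
pose U := fine \o wstar I w phi.
have U0 : 0 <= gauge E U by exact: (gauge_ge0 bfsE EU).
have sup_le : (kothe_sup I Lam f <= (gauge E U)%:E)%E.
  apply: ge_ereal_sup => _ [g [[mg [gfin [mpsi [vfin [mV KV]]]]] g1] <-].
  pose psi := fine \o star I g.
  pose V := fine \o wstar I w psi.
  have V1 : fine (kothe_sup J E V) <= 1 by [].
  apply: le_trans (hardy_littlewood_star mI mf mg) _.
  rewrite lebesgue_measure_itv0 ?(ltW a0)//.
  have mstar h : measurable_fun I (star I h) by exact: measurable_star.
  have mwst h : measurable_fun J (wstar I w h) by exact: measurable_wstar.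
  (* Dividing and multiplying by [w] turns the integral into one for [w dm], ready for the second
     use of Hardy-Littlewood. *)
  have -> : (\int[mu]_(t in I) (star I f t * star I g t) =
      \int[mu]_(t in I) (`|phi t * psi t| * w t)%:E)%E.
    apply: ge0_ae_eq_integral => //.
    - exact: emeasurable_funM (mstar f) (mstar g).
    - apply/measurable_EFinP; apply: measurable_funM => //.
      by apply: measurableT_comp => //; exact: measurable_funM.
    - by move=> t It; rewrite mule_ge0// star_ge0.
    - by move=> t It; rewrite lee_fin mulr_ge0 ?w0.
    - apply: ae_onW (ae_onI swfin gfin) => t It [swf gf].
      have w1 := weight_gt0 dw It.
      have sf : star I f t \is a fin_num.
        move: swf; rewrite /star_over_weight; have := star_ge0 I f t.
        by case: (star I f t) => [r| |]//= _; rewrite gt0_mulye// lte_fin invr_gt0.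
      rewrite /phi /psi /= /star_over_weight fineM//= ger0_norm; last first.
        by rewrite !mulr_ge0 ?fine_ge0 ?star_ge0// invr_ge0 ltW.
      rewrite -[in LHS](fineK sf) -[in LHS](fineK gf) -EFinM; congr EFin.
      by rewrite mulrAC divfK ?gt_eqF.
  apply: le_trans (hardy_littlewood mI mw w0 mphi mpsi) _.
  have -> : (\int[mu]_(t in J) (wstar I w phi t * wstar I w psi t) =
      \int[mu]_(t in J) `|V t * U t|%:E)%E.
    apply: ge0_ae_eq_integral => //.
    - exact: emeasurable_funM (mwst phi) (mwst psi).
    - apply/measurable_EFinP; apply: measurableT_comp => //.
      exact: (measurable_funM mV (carrier_measurable bfsE EU)).
    - by move=> t It; rewrite mule_ge0// rearrangement_ge0.
    - apply: ae_onW (ae_onI wfin vfin) => t Jt [wf vf].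
      rewrite ger0_norm ?mulr_ge0 ?fine_ge0 ?rearrangement_ge0//.
      rewrite -[in LHS](fineK wf) -[in LHS](fineK vf) -EFinM; congr EFin.
      exact: mulrC.
  apply: le_trans (kothe_holder bfsE EU mV KV) _.
  by rewrite lee_fin ler_piMr.
have Kfoo : (kothe_sup I Lam f < +oo)%E by exact: le_lt_trans sup_le (ltry _).
split=> //=; move: sup_le; rewrite -[gauge E U]/(egauge (weighted_space a w E) _).
by case: (kothe_sup I Lam f) => [r| |].
Qed.

End associate_space.

Theorem corollary5p2 (R : realType) (a : \bar R) (w : R -> R)
    (E : fun_space R) :
  let b : \bar R := weight_total a w in
  let I : set R := itv0 a in
  let J : set R := itv0 b in
  (0 < a)%E ->
  decreasing_weight a w ->
  banach_function_space J E ->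
  fully_symmetric b E ->
  has_support J E ->
  fatou_property J E ->
  regular_weight a w ->
  carrier (kothe_dual I (Lambda_space a w (kothe_dual J E)))
    = carrier (M_space a w E) /\
  equivalent_gauges (M_space a w E)
    (kothe_dual I (Lambda_space a w (kothe_dual J E))).
Proof.
move=> b I J a0 dw bfsE fsE suppE fatouE [C C1 wC].
have sub f := @kothe_Lambda_sub_M _ a w E a0 dw bfsE fsE suppE C f C1 wC fatouE.
have sup f := @M_sub_kothe_Lambda _ a w E a0 dw bfsE f.
split; first by apply/seteqP; split => f; [case/sub|case/sup].
have C0 : 0 < C by exact: lt_le_trans C1.
exists 1, (16 * C); split => //; first by rewrite mulr_gt0.
move=> f Mf; have [Kf le1] := sup _ Mf.
by rewrite mul1r; split => //; case: (sub _ Kf).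
Qed.
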